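(* The subgroup $\mathrm{Aut}(\mathbb{T})$ is spherical in $\mathrm{Hier}(\mathbb{T})$: for any irreducible unitary representation of $\mathrm{Hier}(\mathbb{T})$ in a Hilbert space $V$, the subspace $V^{\mathrm{Aut}(\mathbb{T})}$ of $\mathrm{Aut}(\mathbb{T})$-fixed vectors satisfies $\dim V^{\mathrm{Aut}(\mathbb{T})}\le 1$.
   Context: $\mathbb{T}$ is the tree (unique up to isomorphism) in which every vertex has countably infinite valence; $\mathrm{Aut}(\mathbb{T})$ is its automorphism group. A subtree $S\subset\mathbb{T}$ isomorphic to $\mathbb{T}$ is a $(\mathbb{T})$-subtree if only finitely many edges $[a,b]$ of $\mathbb{T}$ satisfy $a\in S$, $b\notin S$. A $(\mathbb{T})$-covering forest is a finite collection of pairwise disjoint $(\mathbb{T})$-subtrees obtained from $\mathbb{T}$ by removing a finite (possibly empty) set of edges, keeping all vertices. A spheromorphism $g$ is given by two $(\mathbb{T})$-covering forests $S_1,\dots,S_k$ and $R_1,\dots,R_k$ and tree isomorphisms $g^{(j)}:S_j\to R_j$; it is identified with the induced permutation of $\mathrm{vert}(\mathbb{T})$. $\mathrm{Hier}(\mathbb{T})\supset\mathrm{Aut}(\mathbb{T})$ is the group of all spheromorphisms. Topology: pointwise stabilizers of finite subtrees form a base of neighborhoods of the identity in $\mathrm{Aut}(\mathbb{T})$, and $\mathrm{Hier}(\mathbb{T})$ carries the group topology in which $\mathrm{Aut}(\mathbb{T})$, with this topology, is an open subgroup (so $\mathrm{Hier}(\mathbb{T})/\mathrm{Aut}(\mathbb{T})$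 is discrete). Unitary representations are assumed continuous. *)

(* Defs.v *)
From HB Require Import structures.
From mathcomp Require Import all_boot all_order all_algebra.
From mathcomp Require Import all_classical all_reals all_analysis.
From mathcomp Require Import complex sesquilinear.

Set Implicit Arguments.
Unset Strict Implicit.
Unset Printing Implicit Defensive.

Import Order.TTheory GRing.Theory Num.Theory.
Import numFieldNormedType.Exports.

Local Open Scope classical_set_scope.

Definition reachable (T : eqType) (e : rel T) (x y : T) : Prop :=
  exists2 p : seq T, path e x p & last x p = y.

Record inftree := InfTree {
  vert :> countType;
  adj : rel vert;
  vert_inhabited : inhabited vert;
  adj_sym : symmetric adj;
  adj_irr : irreflexive adj;
  adj_connected : forall x y, reachable adj x y;
  adj_acyclic : forall c : seq vert, ucycle adj c -> (size c <= 2)%N;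
  adj_valence : forall x, ([set y | adj x y] #= [set: nat])%card }.

Arguments adj {_} _ _.

Section Forests.
Variable T : inftree.
Implicit Types (S : set T) (F : set (T * T)) (g : T -> T).

Definition subtree S : Prop := S !=set0 /\
  forall x y, S x -> S y ->
    reachable [rel a b | [&& adj a b, a \in S & b \in S]] x y.

Definition tree_iso S S' g : Prop :=
  set_bij S S' g /\
  forall x y, S x -> S y -> adj (g x) (g y) = adj x y.

(* An edge with one end in [S] and the other outside is encoded once, by the
   pair listing first the end in [S]. *)
Definition T_subtree S : Prop :=
  [/\ subtree S,
      exists f : T -> T, tree_iso S [set: T] f &
      finite_set [set e : T * T | [/\ adj e.1 e.2, S e.1 & ~ S e.2]]].

(* The tree with the edges [a, b] such that [(a, b)] or [(b, a)] is in [F]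
   removed. *)
Definition cut F : rel T :=
  [rel x y | [&& adj x y, (x, y) \notin F & (y, x) \notin F]].

(* The last clause says that the [S i] are the connected components of what
   is left of the tree after removing [F]. *)
Definition covering_forest (k : nat) (S : 'I_k -> set T) : Prop :=
  [/\ forall i, T_subtree (S i),
      trivIset [set: 'I_k] S,
      \bigcup_i S i = [set: T] &
      exists2 F, finite_set F &
        forall x y, (exists i, S i x /\ S i y) <-> reachable (cut F) x y].

Definition spheromorphism g : Prop :=
  bijective g /\
  exists (k : nat) (S R : 'I_k -> set T),
    [/\ covering_forest S, covering_forest R &
        forall j, tree_iso (S j) (R j) g].

Definition automorphism g : Prop :=
  bijective g /\ forall x y, adj (g x) (g y) = adj x y.

End Forests.

Section Reachable.
Variables (T : eqType) (e : rel T).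

Lemma reachable_refl x : reachable e x x.
Proof. by exists [::]. Qed.

Lemma reachable_trans y x z :
  reachable e x y -> reachable e y z -> reachable e x z.
Proof.
move=> [p ep lp] [q eq lq]; exists (p ++ q); last by rewrite last_cat lp.
by rewrite cat_path ep lp.
Qed.

Lemma reachable1 x y : e x y -> reachable e x y.
Proof. by move=> exy; exists [:: y] => //=; rewrite exy. Qed.

Lemma reachable_sym x y : symmetric e -> reachable e x y -> reachable e y x.
Proof.
move=> es [p + <-] {y}; elim: p x => [|a p IH] x /=.
  by move=> _; exact: reachable_refl.
move=> /andP[exa /IH r]; apply: reachable_trans r _.
by apply: reachable1; rewrite es.
Qed.

Lemma reachable_ind (P : T -> Prop) x y : P x ->
  (forall a b, P a -> e a b -> P b) -> reachable e x y -> P y.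
Proof.
move=> Px Pe [p + <-] {y}; elim: p x Px => //= a p IH x Px /andP[/(Pe _ _ Px)].
exact: IH.
Qed.

End Reachable.

Lemma reachable_map (T T' : eqType) (e : rel T) (e' : rel T') (g : T -> T') x y :
  (forall a b, reachable e x a -> e a b -> e' (g a) (g b)) ->
  reachable e x y -> reachable e' (g x) (g y).
Proof.
move=> ee' rxy.
have [] // : reachable e x y /\ reachable e' (g x) (g y).
elim/reachable_ind: rxy; first by split; exact: reachable_refl.
move=> a b [ra r'a] eab; split.
  by apply: reachable_trans ra _; exact: reachable1.
by apply: reachable_trans r'a _; apply: reachable1; exact: ee'.
Qed.

Section TreeTheory.
Variable T : inftree.
Implicit Types (x y : T) (p q : seq T).

Lemma uniq_path_eq x p q : path adj x p -> path adj x q ->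
  uniq (x :: p) -> uniq (x :: q) -> last x p = last x q -> p = q.
Proof.
elim: p q x => [|a p IH] [|b q] x //.
- by move=> _ _ _ /= /andP[xq _] lq; move: xq; rewrite lq mem_last.
- by move=> _ _ /= /andP[xq _] _ lq; move: xq; rewrite -lq mem_last.
rewrite /=; move=> /andP[xa ap] /andP[xb bq] /andP[xp up] /andP[xq uq] pq.
have [eab|nab] := eqVneq a b; first by rewrite -eab in bq uq pq *; rewrite (IH q a).
suff : False by [].
pose r := p ++ rev (belast b q).
have ra : path adj a r.
  rewrite /r cat_path ap pq /= rev_path; apply: sub_path bq => u v /=.
  by rewrite adj_sym.
have lr : last a r = b.
  rewrite /r last_cat pq; case: (q) => //= c s.
  by rewrite rev_cons last_rcons.
have xr : x \notin a :: r.
  rewrite -cat_cons mem_cat negb_or xp mem_rev.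
  by apply: contra xq; exact: mem_belast.
case: (shortenP ra) lr => r' r'a ur' sr' lr'.
have := @adj_acyclic T (x :: a :: r'); rewrite /ucycle /= rcons_path xa r'a lr'.
rewrite adj_sym xb /= -/(uniq (a :: r')) ur' andbT.
have -> : x \notin a :: r'.
  by apply: contra xr; rewrite !inE => /orP[->//|/sr' ->]; rewrite orbT.
move=> /(_ isT); case: r' lr' {r'a ur' sr'} => //= eab.
by rewrite eab eqxx in nab.
Qed.

Lemma uniq_path_nbr x y q : path adj x q -> uniq (x :: q) -> adj x y ->
  y \in q -> exists q', q = y :: q'.
Proof.
move=> + + xy yq; case/splitPr: yq => p1 p2.
rewrite -cat_rcons cat_path -cat_cons cat_uniq => /andP[pp1 _] /andP[u1 _].
suff : rcons p1 y = [:: y].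
  by case: p1 {pp1 u1} => [_|a []//]; exists p2.
apply: uniq_path_eq pp1 _ u1 _ _; rewrite /= ?xy ?last_rcons // inE andbT.
by apply/eqP => exy; rewrite exy adj_irr in xy.
Qed.

(* Isomorphisms are built from a coding of the vertices by [seq nat]. *)
Definition coded (S : set T) (v : seq nat -> T) :=
  set_bij [set: seq nat] S v /\
  forall s t, adj (v s) (v t) <->
    (exists n, s = n :: t) \/ (exists n, t = n :: s).

Lemma code_exists (S : set T) : subtree S ->
  (forall x, S x -> infinite_set [set y | adj x y /\ S y]) ->
  exists v, coded S v.
Proof.
move=> [[r Sr] Sc] Sinf.
have /choice[nb nbP] : forall xo : T * option T, exists f : nat -> T,
    S xo.1 ->
    set_bij [set: nat] [set y | [/\ adj xo.1 y, S y & Some y <> xo.2]] f.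
  move=> [x o] /=; have [Sx|] := pselect (S x); last by exists (fun=> x).
  pose A := [set y | [/\ adj x y, S y & Some y <> o]].
  have iA : infinite_set A.
    apply: sub_infinite_set (infinite_setD (Sinf x Sx) _) => [y|]; last first.
      exact: (finite_set1 (odflt x o)).
    by move=> -[[xy Sy] /= yo]; split => // oy; apply: yo; rewrite -oy.
  have /card_set_bijP[f [_ fi fs]] := eq_card_nat (countableP A) iA.
  have /choice[h hP] : forall n, exists y, A y /\ f y = n.
    by move=> n; have [y Ay <-] := fs n I; exists y.
  exists h => _; split => [n _|m n _ _ /(congr1 f)|y Ay].
  - exact: (hP n).1.
  - by rewrite (hP m).2 (hP n).2.
  - exists (f y) => //; apply: fi; rewrite ?inE; first exact: (hP _).1.
      exact: Ay.
    by rewrite (hP _).2.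
pose code := fix code s := if s is n :: s' then
  let xo := code s' in (nb xo n, Some xo.1) else (r, None).
pose v s := (code s).1.
pose tl := fix tl s := if s is n :: s' then v s' :: tl s' else [::].
have Sv s : S (v s).
  elim: s => [|n s Ss] //; rewrite /v /=.
  by have [/(_ n I)[]] := nbP _ Ss.
have vP n s : [/\ adj (v s) (v (n :: s)) & Some (v (n :: s)) <> (code s).2].
  by have [/(_ n I)[]] := nbP _ (Sv s).
have ptl s : path adj (v s) (tl s).
  by elim: s => //= n s ->; rewrite adj_sym (vP n s).1.
have ltl s : last (v s) (tl s) = r by elim: s.
have utl s : uniq (v s :: tl s).
  elim: s => // n s IH; rewrite cons_uniq IH andbT inE negb_or.
  apply/andP; split.
    by apply/eqP => vv; have [] := vP n s; rewrite vv adj_irr.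
  apply/negP => /(uniq_path_nbr (ptl s) IH (vP n s).1)[q' eq'].
  have [_] := vP n s; case: s eq' {IH} => //= m s [<- _]; exact.
have tl_eq s t : v s = v t -> tl s = tl t.
  move=> st; apply: (@uniq_path_eq (v s)) => //; first by rewrite st.
    by rewrite st.
  by rewrite ltl st ltl.
have vI s t : v s = v t -> s = t.
  elim: s t => [|m s IH] [|n t] // st; have := tl_eq _ _ st => //=.
  move=> [/IH est _]; rewrite est; congr (_ :: _); move: st; rewrite est /v /=.
  have [_ nbI _] := nbP _ (Sv t); move=> /(nbI _ _ (in_setT _) (in_setT _)).
  by move->.
have vN s y : S y -> adj (v s) y ->
    exists t, v t = y /\ ((exists n, s = n :: t) \/ (exists n, t = n :: s)).
  move=> Sy sy; have [yo|yo] := eqVneq (Some y) (code s).2.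
    case: s sy yo => //= m s _ [->]; exists s; split => //.
    by left; exists m.
  have [_ _ /(_ y)[|n _ <-]] := nbP _ (Sv s).
    by split => //; exact/eqP.
  by exists (n :: s); split => //; right; exists n.
exists v; split; last first.
  move=> s t; split; first by move=> /(vN s _ (Sv t))[t' [/vI ->]].
  move=> [[n ->]|[n ->]]; last by have [] := vP n s.
  by rewrite adj_sym; have [] := vP n t.
split => [s _|s t _ _|y Sy]; [exact: Sv|exact: vI|].
elim/reachable_ind: (Sc r y Sr Sy); first by exists [::].
move=> a b [s _ <-] /= /and3P[sb _]; rewrite inE => Sb.
by have [t [<- _]] := vN s b Sb sb; exists t.
Qed.

Lemma tree_inhab : exists r : T, True.
Proof. by have [r] := vert_inhabited T; exists r. Qed.

Lemma subtreeT : subtree [set: T].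
Proof.
split; first by have [r _] := tree_inhab; exists r.
move=> x y _ _; have [p xp <-] := adj_connected x y; exists p => //.
by apply: sub_path xp => a b ab /=; rewrite ab !in_setT.
Qed.

Lemma adj_infinite x : infinite_set [set y | adj x y].
Proof.
move=> fx; apply: infinite_nat; move: fx.
by rewrite (eq_finite_set (adj_valence x)).
Qed.

Lemma subtree_iso (S : set T) : subtree S ->
  (forall x, S x -> infinite_set [set y | adj x y /\ S y]) ->
  exists f : T -> T, tree_iso S [set: T] f.
Proof.
move=> /code_exists /[apply] -[v [[vf vi vs] va]].
have [|w [[_ wi ws] wa]] := code_exists subtreeT.
  move=> x _; apply: sub_infinite_set (@adj_infinite x) => y /= xy; split=> //.
have /choice[c cP] : forall x, exists s, S x -> v s = x.
  move=> x; have [/vs[s _ <-]|] := pselect (S x); first by exists s.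
  by exists [::].
exists (w \o c); split; last first.
  move=> x y Sx Sy /=; apply/idP/idP => [/wa/va|].
    by rewrite (cP x Sx) (cP y Sy).
  by rewrite -{1}(cP x Sx) -{1}(cP y Sy) => /va/wa.
split => // [x y|y _] /=.
  rewrite !inE => Sx Sy /wi; rewrite !in_setT => /(_ isT isT) cxy.
  by rewrite -(cP x Sx) -(cP y Sy) cxy.
have [s _ <-] := ws y I; exists (v s); first exact: vf.
by rewrite (vi (c (v s)) s) ?in_setT // cP //; exact: vf.
Qed.

Lemma cut_sym (F : set (T * T)) : symmetric (cut F).
Proof. by move=> x y; rewrite /cut /= adj_sym [X in _ && X]andbC. Qed.

Lemma reachable_cut_adj (F : set (T * T)) x y :
  reachable (cut F) x y -> adj x y -> cut F x y.
Proof.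
move=> [p xp]; case: (shortenP xp) => q xq uq _ lq xy.
have eq : q = [:: y].
  apply: (@uniq_path_eq x) => //=; rewrite ?xy //.
    by apply: sub_path xq => a b /andP[].
  by rewrite inE andbT; apply/eqP => exy; rewrite exy adj_irr in xy.
by move: xq; rewrite eq /= andbT.
Qed.

Definition ends (F : set (T * T)) : set T := (fst @` F) `|` (snd @` F).

Lemma finite_ends F : finite_set F -> finite_set (ends F).
Proof. by move=> fF; rewrite finite_setU; split; exact: finite_image. Qed.

Lemma adj_cut (F : set (T * T)) x y : adj x y -> ~ ends F x -> cut F x y.
Proof.
move=> xy Fx; apply/and3P; split => //; apply/negP; rewrite inE => Fe; apply: Fx.
  by left; exists (x, y).
by right; exists (y, x).
Qed.

Lemma component_T_subtree (F : set (T * T)) (S : set T) : finite_set F ->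
  S !=set0 -> (forall x y, S x -> (S y <-> reachable (cut F) x y)) ->
  T_subtree S.
Proof.
move=> fF S0 SP; have subS : subtree S.
  split => // x y Sx Sy; have /(SP x y Sx) := Sy.
  apply: (@reachable_map _ _ _ _ id) => a b xa ab /=.
  have Sa : S a by apply/(SP x).
  have Sb : S b by apply/(SP a) => //; exact: reachable1.
  by rewrite (andP ab).1 !mem_set.
split => //.
  apply: subtree_iso => // x Sx.
  apply: sub_infinite_set (infinite_setD (@adj_infinite x) (finite_ends fF)).
  move=> y [/= xy Fy]; split => //; apply/(SP x) => //; apply: reachable1.
  by rewrite cut_sym; apply: adj_cut => //; rewrite adj_sym.
apply: (@sub_finite_set _ _ (F `|` (fun e => (e.2, e.1)) @` F)); last first.
  by rewrite finite_setU; split => //; exact: finite_image.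
move=> [x y] [/= xy Sx Sy]; have : ~ cut F x y.
  by move=> c; apply: Sy; apply/(SP x) => //; exact: reachable1.
rewrite /cut /= xy /= => /negP; rewrite negb_and !negbK => /orP[]; rewrite inE => ?; first by left.
by right; exists (y, x).
Qed.

Lemma components_covering_forest (F : set (T * T)) k (S : 'I_k -> set T) :
  finite_set F -> (forall i, S i !=set0) -> trivIset [set: 'I_k] S ->
  (forall x y, (exists i, S i x /\ S i y) <-> reachable (cut F) x y) ->
  covering_forest S.
Proof.
move=> fF S0 ST SP; split => //; last by exists F.
  move=> i; apply: (component_T_subtree fF) => // x y Six.
  rewrite -SP; split => [Siy|[j [Sjx Sjy]]]; first by exists i.
  by rewrite (ST i j) //; exists x.
rewrite -subTset => x _.
by have [_ /(_ (reachable_refl _ x))[i [Six _]]] := SP x x; exists i.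
Qed.

Lemma components_exist (F : set (T * T)) : finite_set F ->
  exists k (S : 'I_k -> set T),
    [/\ forall i, S i !=set0, trivIset [set: 'I_k] S &
      forall x y, (exists i, S i x /\ S i y) <-> reachable (cut F) x y].
Proof.
move=> fF; have [r _] := tree_inhab.
pose C x := [set y | reachable (cut F) x y].
have CE x y : reachable (cut F) x y -> C x = C y.
  move=> xy; apply/seteqP; split => z /= h.
    by apply: reachable_trans h; apply: reachable_sym => //; exact: cut_sym.
  exact: reachable_trans h.
have : finite_set (C @` (r |` ends F)).
  apply: finite_image; rewrite finite_setU; split; first exact: finite_set1.
  exact: finite_ends.
move=> /finite_seqP[s sE].
have Cs x : C x \in s.
  have : [set` s] (C x) => //; rewrite -sE.
  have [p xp lp] := adj_connected x r; elim: p x xp lp => [x _ <-|a p IH x].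
    by exists x => //; left.
  move=> /= /andP[xa ap] lp; have [Fx|Fx] := pselect (ends F x).
    by exists x => //; right.
  by rewrite (CE x a); [exact: IH|apply: reachable1; exact: adj_cut].
exists (size (undup s)), (fun i => tnth (in_tuple (undup s)) i).
have SC i x : tnth (in_tuple (undup s)) i x -> tnth (in_tuple (undup s)) i = C x.
  have : tnth (in_tuple (undup s)) i \in s.
    by rewrite -mem_undup; exact: mem_tnth.
  move=> si; have : [set` s] (tnth (in_tuple (undup s)) i) by [].
  by rewrite -sE => -[y _ <-]; exact: CE.
split => [i|i j _ _ [x [/SC ix /SC jx]]|x y].
- have : tnth (in_tuple (undup s)) i \in s.
    by rewrite -mem_undup; exact: mem_tnth.
  move=> si; have : [set` s] (tnth (in_tuple (undup s)) i) by [].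
  by rewrite -sE => -[y _ <-]; exists y; exact: reachable_refl.
- apply/eqP; rewrite -(inj_eq val_inj) /=.
  rewrite -(nth_uniq set0 (ltn_ord i) (ltn_ord j) (undup_uniq s)).
  by move: ix jx; rewrite !(tnth_nth set0) /= => -> ->.
- split => [[i [/SC -> //]]|xy].
  have : C x \in undup s by rewrite mem_undup.
  move=> /(nthP set0)[i si iC]; exists (Ordinal si).
  by rewrite (tnth_nth set0) /= iC; split => //; exact: reachable_refl.
Qed.

(* A permutation is a spheromorphism when it alters the adjacency of finitely
   many pairs only. *)
Definition defect (g : T -> T) : set (T * T) :=
  [set e | adj (g e.1) (g e.2) != adj e.1 e.2].

Lemma spheromorphismP (g : T -> T) :
  spheromorphism g <-> bijective g /\ finite_set (defect g).
Proof.
pose sw (F : set (T * T)) := F `|` (fun e => (e.2, e.1)) @` F.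
have fsw F : finite_set F -> finite_set (sw F).
  by move=> fF; rewrite finite_setU; split => //; exact: finite_image.
have ncut F x y : adj x y -> ~ cut F x y -> sw F (x, y).
  move=> xy; rewrite /cut /= xy /= => /negP; rewrite negb_and !negbK => /orP[]; rewrite inE => ?.
    by left.
  by right; exists (y, x).
split=> [[gb [k [S [R [[_ _ SU [F fF SP]] [_ RI RU [F' fF' RP]] iso]]]]]|].
  split => //; apply: (@sub_finite_set _ _
      (sw F `|` (fun e => (g e.1, g e.2)) @^-1` sw F')); last first.
    rewrite finite_setU; split; first exact: fsw.
    apply: finite_preimage; last exact: fsw.
    by move=> [a b] [c d] _ _ /= [/(bij_inj gb) -> /(bij_inj gb) ->].
  move=> [x y]; rewrite /defect /=.
  have [xy|nxy] := boolP (adj x y).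
    rewrite eqb_id => gxy; left; apply: ncut => // /reachable1/SP[i [Sx Sy]].
    by move: gxy; rewrite (iso i).2 ?xy.
  rewrite eqbF_neg negbK => gxy; right; apply: ncut => // /reachable1/RP[i [Rx Ry]].
  have [[_ _ gs] ga] := iso i.
  have [x' Sx /(bij_inj gb) ex] := gs _ Rx; rewrite {}ex in Sx.
  have [y' Sy /(bij_inj gb) ey] := gs _ Ry; rewrite {}ey in Sy.
  by move: nxy; rewrite -ga // gxy.
move=> [gb fD]; split => //; pose gg (e : T * T) := (g e.1, g e.2).
have [k [S [S0 SI SP]]] := components_exist fD.
pose F' := gg @` defect g; have fF' : finite_set F' by exact: finite_image.
have F'E a b : ((g a, g b) \in F') = ((a, b) \in defect g).
  apply/idP/idP; rewrite !inE; last by move=> ?; exists (a, b).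
  by move=> [[c d] ? [/(bij_inj gb) <- /(bij_inj gb) <-]].
have cutE a b : cut F' (g a) (g b) = cut (defect g) a b.
  rewrite /cut /= !F'E; have [|] := boolP ((a, b) \in defect g).
    by rewrite !andbF.
  by rewrite notin_setE /defect /= => /negP; rewrite negbK => /eqP ->.
have [h gK hK] := gb.
have rE x y : reachable (cut F') (g x) (g y) <-> reachable (cut (defect g)) x y.
  split; last by apply: reachable_map => a b _; rewrite cutE.
  rewrite -{2}(gK x) -{2}(gK y); apply: reachable_map => a b _.
  by rewrite -cutE !hK.
exists k, S, (fun i => g @` S i); split.
- exact: components_covering_forest SP.
- apply: (components_covering_forest fF') => [i|i j _ _|x y].
  + by have [x Sx] := S0 i; exists (g x); exists x.
  + move=> [z [[x Sx <-] [y Sy /(bij_inj gb) yx]]]; rewrite yx in Sy.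
    by apply: SI => //; exists x.
  + rewrite -(hK x) -(hK y) rE -SP; split => [[i [[a Sa]]]|[i [Sx Sy]]].
      by move=> /(bij_inj gb) <- [b Sb /(bij_inj gb) <-]; exists i.
    by exists i; split; [exists (h x)|exists (h y)].
- move=> i; split; first split.
  + by move=> x Sx; exists x.
  + by move=> x y _ _; exact: (bij_inj gb).
  + by move=> y [x Sx <-]; exists x.
  + move=> x y Sx Sy.
    have xy : reachable (cut (defect g)) x y by apply/SP; exists i.
    apply/idP/idP => [gxy|/(reachable_cut_adj xy)].
      have := reachable_cut_adj ((rE x y).2 xy) gxy.
      by rewrite cutE => /andP[].
    by rewrite -cutE => /andP[].
Qed.

Lemma automorphism_spheromorphism (g : T -> T) :
  automorphism g -> spheromorphism g.
Proof.
move=> [gb ga]; apply/spheromorphismP; split => //.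
rewrite (_ : defect g = set0) //; apply/seteqP; split => // -[x y].
by rewrite /defect /= ga eqxx.
Qed.

Lemma spheromorphism_id : spheromorphism (@id T).
Proof. by apply: automorphism_spheromorphism; split => //; exists id. Qed.

Lemma spheromorphism_comp (g h : T -> T) :
  spheromorphism g -> spheromorphism h -> spheromorphism (g \o h).
Proof.
move=> /spheromorphismP[gb fg] /spheromorphismP[hb fh]; apply/spheromorphismP.
split; first exact: bij_comp.
apply: (@sub_finite_set _ _
    (defect h `|` (fun e => (h e.1, h e.2)) @^-1` defect g)).
  move=> [x y] /= gh; have [e|?] := eqVneq (adj (h x) (h y)) (adj x y).
    by right; rewrite /defect /= e.
  by left.
rewrite finite_setU; split => //; apply: finite_preimage => //.
by move=> [a b] [c d] _ _ /= [/(bij_inj hb) -> /(bij_inj hb) ->].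
Qed.

Lemma spheromorphism_can (g h : T -> T) :
  cancel g h -> cancel h g -> spheromorphism g -> spheromorphism h.
Proof.
move=> gK hK /spheromorphismP[gb fg]; apply/spheromorphismP.
split; first by exists g.
apply: sub_finite_set (finite_image (fun e => (g e.1, g e.2)) fg).
move=> [x y] /= xy; exists (h x, h y); rewrite /= ?hK //.
by rewrite /defect /= !hK eq_sym.
Qed.

End TreeTheory.

(* An instance, whose vertices are the finite sequences of integers, each one
   joined to its one-term extensions. *)
Section Existence.

Definition seq_adj : rel (seq nat) := [rel s t |
  ((s != [::]) && (behead s == t)) || ((t != [::]) && (behead t == s))].

Lemma seq_adj_sym : symmetric seq_adj.
Proof. by move=> s t; rewrite /seq_adj /= orbC. Qed.

Lemma seq_adj_irr : irreflexive seq_adj.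
Proof.
have h (n : nat) (s : seq nat) : (s == n :: s) = false.
  by apply/eqP => /(congr1 size) /eqP; rewrite /= (ltn_eqF (ltnSn _)).
by case=> [|n s]; rewrite /seq_adj /= ?h.
Qed.

Lemma seq_adj_connected s t : reachable seq_adj s t.
Proof.
have r0 u : reachable seq_adj u [::].
  elim: u => [|n u IH]; first exact: reachable_refl.
  by apply: reachable_trans IH; apply: reachable1; rewrite /seq_adj /= eqxx.
by apply: reachable_trans (r0 s) _; exact: reachable_sym seq_adj_sym (r0 t).
Qed.

Lemma seq_adj_le s t : seq_adj s t -> (size t <= size s)%N -> t = behead s.
Proof.
move=> /orP[] /andP[+ /eqP <-] //.
by case: t => // n t _ /=; rewrite ltnn.
Qed.

Lemma seq_adj_acyclic (c : seq (seq nat)) : ucycle seq_adj c -> (size c <= 2)%N.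
Proof.
move=> /andP[cc uc]; case: c cc uc => // s0 c0; set c := s0 :: c0 => cc uc.
have [x xc xmax] : exists2 x, x \in c & forall y, y \in c -> (size y <= size x)%N.
  rewrite /c; elim: (c0) (s0) => [|t d IH] s.
    by exists s => [|y]; rewrite ?mem_head // inE => /eqP ->.
  have [x xd xm] := IH t; have [sx|xs] := leqP (size s) (size x).
    exists x => [|y]; first by rewrite inE xd orbT.
    by rewrite inE => /orP[/eqP -> //|]; exact: xm.
  exists s => [|y]; rewrite ?mem_head // inE => /orP[/eqP -> //|/xm].
  by move=> /leq_trans -> //; exact: ltnW.
have [i c' ec] := rot_to xc.
have cc' : cycle seq_adj (x :: c') by rewrite -ec rot_cycle.
have uc' : uniq (x :: c') by rewrite -ec rot_uniq.
have m' y : y \in c' -> (size y <= size x)%N.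
  by move=> yc; apply: xmax; rewrite -(mem_rot i) ec inE yc orbT.
rewrite -(size_rot i) ec; case/lastP: c' cc' uc' m' {ec} => // c' b.
rewrite /= rcons_path last_rcons => /andP[+ bx] /andP[_ +] m'.
have -> : b = behead x.
  by apply: seq_adj_le; rewrite 1?seq_adj_sym // m' // mem_rcons mem_head.
case: c' m' => // a c' m' /= /andP[xa _] /andP[+ _].
rewrite (seq_adj_le xa); last by apply: m'; exact: mem_head.
by rewrite mem_rcons mem_head.
Qed.

Lemma seq_adj_valence s : ([set t | seq_adj s t] #= [set: nat])%card.
Proof.
apply: eq_card_nat; first exact: countableP.
apply: (@sub_infinite_set _ (range (fun n => n :: s))) => [_ [n _ <-] /=|].
  by rewrite /seq_adj /= eqxx orbT.
move=> /(finite_image (head 0)) fN; apply: infinite_nat.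
by apply: sub_finite_set fN => n _; exists (n :: s) => //; exists n.
Qed.

Definition seq_inftree : inftree := InfTree (inhabits [::])
  seq_adj_sym seq_adj_irr seq_adj_connected seq_adj_acyclic seq_adj_valence.

End Existence.

(* Product in [hier T] is composition: [(g * h) x = g (h x)]. *)
Record hier (T : inftree) := Hier {
  hier_fun :> T -> T;
  hierP : spheromorphism hier_fun }.

Section HierGroup.
Variable T : inftree.
Implicit Types g h : hier T.

Lemma hier_eq g h : g =1 h -> g = h.
Proof.
case: g h => [g gP] [h hP] /= /funext gh; rewrite {}gh in gP *.
by rewrite (Prop_irrelevance gP hP).
Qed.

HB.instance Definition _ := gen_eqMixin (hier T).
HB.instance Definition _ := gen_choiceMixin (hier T).

Lemma hier_inv_exists g : exists h : hier T, cancel g h /\ cancel h g.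
Proof.
have [h gK hK] := (hierP g).1.
by exists (Hier (spheromorphism_can gK hK (hierP g))).
Qed.

Definition hier_one := Hier (spheromorphism_id T).
Definition hier_mul g h := Hier (spheromorphism_comp (hierP g) (hierP h)).
Definition hier_inv g := sval (cid (hier_inv_exists g)).

Lemma hier_invK g : cancel g (hier_inv g).
Proof. exact: (svalP (cid (hier_inv_exists g))).1. Qed.

Lemma hier_Kinv g : cancel (hier_inv g) g.
Proof. exact: (svalP (cid (hier_inv_exists g))).2. Qed.

Lemma hier_mulA : associative hier_mul.
Proof. by move=> g h k; exact: hier_eq. Qed.

Lemma hier_mul1 : left_id hier_one hier_mul.
Proof. by move=> g; exact: hier_eq. Qed.

Lemma hier_mulr1 : right_id hier_one hier_mul.
Proof. by move=> g; exact: hier_eq. Qed.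

Lemma hier_mulV : left_inverse hier_one hier_inv hier_mul.
Proof. by move=> g; apply: hier_eq => x /=; rewrite hier_invK. Qed.

Lemma hier_mulrV : right_inverse hier_one hier_inv hier_mul.
Proof. by move=> g; apply: hier_eq => x /=; rewrite hier_Kinv. Qed.

HB.instance Definition _ := isGroup.Build (hier T)
  hier_mulA hier_mul1 hier_mulr1 hier_mulV hier_mulrV.

Lemma hierM g h x : (g * h)%g x = g (h x).
Proof. by []. Qed.

Lemma hierVK g x : (g^-1)%g (g x) = x.
Proof. exact: hier_invK. Qed.

Lemma hierKV g x : g ((g^-1)%g x) = x.
Proof. exact: hier_Kinv. Qed.

End HierGroup.

(* [Aut T] is all of the automorphism group by [automorphism_spheromorphism]. *)
Definition Aut (T : inftree) : set (hier T) := [set g | automorphism g].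
Arguments Aut T : clear implicits.

Definition stabilizer (T : inftree) (A : set T) : set (hier T) :=
  Aut T `&` [set g | forall x, A x -> g x = x].

(* The sets [g * stabilizer A], for [A] a finite subtree, form a base of
   neighborhoods of [g]. *)
Definition hier_nbhs (T : inftree) (g : hier T) : set_system (hier T) :=
  [set U | exists A : set T, [/\ finite_set A, subtree A &
     forall h, stabilizer A h -> U (g * h)%g]].

HB.mixin Record Group_isTopologicalGroup G of Group G & Topological G := {
  mulg_continuous : continuous (fun gh : G * G => (gh.1 * gh.2)%g);
  invg_continuous : continuous (fun g : G => (g^-1)%g) }.

#[short(type="topologicalGroupType")]
HB.structure Definition TopologicalGroup :=
  { G of Group_isTopologicalGroup G & Group G & Topological G }.

Section HierTopology.
Variable T : inftree.
Implicit Types (g h : hier T) (A : set T).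

Lemma subtree_hull A : finite_set A ->
  exists B : set T, [/\ finite_set B, subtree B & A `<=` B].
Proof.
move=> /finite_seqP[s ->]; have [r _] := tree_inhab T.
pose ind (q : seq T) :=
  [rel a b : T | [&& adj a b, a \in [set` q] & b \in [set` q]]].
have [q [rq sq qc]] : exists q : seq T, [/\ r \in q, {subset s <= q} &
    forall x, x \in q -> reachable (ind q) r x].
  elim: s => [|y s [q [rq sq qc]]].
    exists [:: r]; split => //; first exact: mem_head.
    by move=> x; rewrite inE => /eqP ->; exact: reachable_refl.
  have [p rp py] := adj_connected r y; exists (r :: p ++ q).
  have sub (q1 q2 : seq T) (x z : T) : {subset q1 <= q2} ->
      reachable (ind q1) x z -> reachable (ind q2) x z.
    move=> q12; apply: (@reachable_map _ _ _ _ id) => a b _ /= /and3P[->].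
    by rewrite !in_setE /= => /q12 aq /q12 bq; rewrite !mem_set.
  split; first exact: mem_head.
  - move=> x; rewrite inE => /orP[/eqP ->|/sq xq].
      by rewrite -cat_cons mem_cat -py mem_last.
    by rewrite -cat_cons mem_cat xq orbT.
  - move=> x; rewrite -cat_cons mem_cat => /orP[|/qc]; last first.
      by apply: sub => z zq; rewrite mem_cat zq orbT.
    move=> xp; apply: (sub (r :: p)) => [z zp|]; first by rewrite mem_cat zp.
    case/splitPl: xp rp {py} => p1 p2 <-; rewrite cat_path => /andP[rp1 _].
    exists p1 => //; have : {subset r :: p1 <= r :: p1 ++ p2}.
      by move=> z; rewrite -cat_cons mem_cat => ->.
    move: (r :: p1 ++ p2) => w; elim: p1 (r) rp1 => //= a p1 IH z.
    move=> /andP[za ap] zw; rewrite za !mem_set /=; last 2 first.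
    + by apply: zw; rewrite !inE eqxx orbT.
    + by apply: zw; rewrite mem_head.
    by apply: IH => // u up; apply: zw; rewrite inE up orbT.
have indS : symmetric (ind q).
  by move=> a b; rewrite /= adj_sym [X in _ && X]andbC.
exists [set` q]; split => //; split; first by exists r.
move=> x y /qc rx /qc ry; apply: reachable_trans ry.
exact: reachable_sym.
Qed.

Lemma stabilizerS A B : A `<=` B -> stabilizer B `<=` stabilizer A.
Proof. by move=> AB h [ha hB]; split => // x /AB; exact: hB. Qed.

Lemma stabilizer1 A : stabilizer A 1%g.
Proof. by split => //; split => //; exists id. Qed.

Lemma stabilizerM A g h : stabilizer A g -> stabilizer A h ->
  stabilizer A (g * h)%g.
Proof.
move=> [[gb ga] gA] [[hb ha] hA]; split.
  by split; [exact: bij_comp|move=> x y; rewrite ga ha].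
by move=> x Ax; rewrite hierM hA // gA.
Qed.

Lemma stabilizerV A g : stabilizer A g -> stabilizer A (g^-1)%g.
Proof.
move=> [[gb ga] gA]; split; last by move=> x /gA {1}<-; rewrite hierVK.
split; first by exists g => x; rewrite ?hierVK ?hierKV.
by move=> x y; rewrite -ga !hierKV.
Qed.

Lemma hier_nbhs_proper g : ProperFilter (hier_nbhs g).
Proof.
split=> [[A [_ _ /(_ _ (stabilizer1 A))]]//|]; split.
- have [r _] := tree_inhab T.
  have [B [fB sB _]] := subtree_hull (finite_set1 r).
  by exists B.
- move=> U V [A [fA sA AU]] [B [fB sB BV]].
  have [|C [fC sC ABC]] := @subtree_hull (A `|` B).
    by rewrite finite_setU.
  exists C; split => // h hC.
  split; [apply: AU|apply: BV]; apply: stabilizerS hC => x xAB; apply: ABC.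
    by left.
  by right.
- by move=> U V UV [A [fA sA AU]]; exists A; split => // h /AU /UV.
Qed.

Lemma hier_nbhs_singleton g (U : set (hier T)) : hier_nbhs g U -> U g.
Proof. by move=> [A [_ _ /(_ _ (stabilizer1 A))]]; rewrite mulg1. Qed.

Lemma hier_nbhs_nbhs g (U : set (hier T)) :
  hier_nbhs g U -> hier_nbhs g (fun h => hier_nbhs h U).
Proof.
move=> [A [fA sA AU]]; exists A; split => // h hA.
exists A; split => // k kA; rewrite -mulgA; apply: AU; exact: stabilizerM.
Qed.

HB.instance Definition _ := hasNbhs.Build (hier T) (@hier_nbhs T).
HB.instance Definition _ := Nbhs_isNbhsTopological.Build (hier T)
  hier_nbhs_proper hier_nbhs_singleton hier_nbhs_nbhs.

Lemma stabilizer_conj g A : finite_set A -> exists B : set T,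
  [/\ finite_set B, subtree B &
      forall u, stabilizer B u -> stabilizer A (g^-1 * u * g)%g].
Proof.
move=> fA; have [gb fD] := (spheromorphismP g).1 (hierP g).
have [|B [fB sB EB]] := @subtree_hull (g @` (A `|` ends (defect g))).
  by apply: finite_image; rewrite finite_setU; split => //; exact: finite_ends.
exists B; split => // u [[ub ua] uB].
have fixg x : (A `|` ends (defect g)) x -> u (g x) = g x.
  by move=> xA; apply: uB; apply: EB; exists x.
split; last first.
  by move=> x Ax; rewrite !hierM fixg ?hierVK //; left.
pose k := (g^-1 * u * g)%g; have kE x : g (k x) = u (g x) by exact: hierKV.
split; first exact: (hierP k).1.
move=> x y; have [e|D] := eqVneq (adj (g x) (g y)) (adj x y); last first.
  rewrite !hierM !fixg ?hierVK //; right.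
    by right; exists (x, y).
  by left; exists (x, y).
have [|D] := eqVneq (adj (g (k x)) (g (k y))) (adj (k x) (k y)).
  by move=> <-; rewrite !kE ua.
have kfix z : ends (defect g) (k z) -> k z = z.
  move=> zD; apply: (bij_inj gb); apply: (bij_inj ub).
  by rewrite fixg ?kE //; right.
have kx : k x = x by apply: kfix; left; exists (k x, k y).
have ky : k y = y by apply: kfix; right; exists (k x, k y).
by rewrite -[LHS]/(adj (k x) (k y)) kx ky.
Qed.

Lemma hier_mul_continuous :
  continuous (fun gh : hier T * hier T => (gh.1 * gh.2)%g).
Proof.
move=> [g h] U [A [fA sA AU]]; have [B [fB sB BA]] := stabilizer_conj h fA.
exists ([set (g * u)%g | u in stabilizer B],
        [set (h * v)%g | v in stabilizer A]).
  split; [exists B|exists A]; split => // u uS; by exists u.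
move=> [_ _] [/= [u uB <-] [v vA <-]]; rewrite /=.
rewrite (_ : (g * u * (h * v) = g * h * (h^-1 * u * h * v))%g).
  by apply: AU; apply: stabilizerM => //; exact: BA.
by apply: hier_eq => x; rewrite !hierM hierKV.
Qed.

Lemma hier_inv_continuous : continuous (fun g : hier T => (g^-1)%g).
Proof.
move=> g U [A [fA sA AU]]; have [B [fB sB BA]] := stabilizer_conj (g^-1)%g fA.
exists B; split => // u uB /=.
rewrite (_ : ((g * u)^-1 = g^-1 * ((g^-1)^-1 * u^-1 * g^-1))%g).
  by apply: AU; apply: BA; exact: stabilizerV.
by rewrite invgM invgK !mulgA mulVg mul1g.
Qed.

HB.instance Definition _ := Group_isTopologicalGroup.Build (hier T)
  hier_mul_continuous hier_inv_continuous.

Lemma Aut_open : open (Aut T).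
Proof.
rewrite openE => g [gb ga]; have [r _] := tree_inhab T.
have [B [fB sB _]] := subtree_hull (finite_set1 r).
exists B; split => // h [[hb ha] _].
by split; [exact: bij_comp|move=> x y; rewrite ga ha].
Qed.

End HierTopology.

Local Open Scope ring_scope.

(* A Hilbert space is a complete normed space whose norm comes from an inner
   product, linear in its first argument. *)
Record hilbertType (R : realType) := HilbertType {
  hilbert_sort :> completeNormedModType R[i];
  inner : {dot hilbert_sort for Num.conj};
  inner_norm : forall v : hilbert_sort, `|v| ^+ 2 = inner v v }.

Record unitary_rep (R : realType) (G : topologicalGroupType)
    (V : hilbertType R) := UnitaryRep {
  rep :> G -> {linear V -> V};
  rep1 : forall v, rep 1%g v = v;
  repM : forall g h v, rep (g * h)%g v = rep g (rep h v);
  rep_unitary : forall g u v, inner V (rep g u) (rep g v) = inner V u v;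
  rep_continuous : forall v, continuous (fun g => rep g v) }.

Section Representations.
Variables (R : realType) (G : topologicalGroupType) (V : hilbertType R).
Implicit Type pi : unitary_rep G V.

Definition closed_subspace (W : set V) : Prop :=
  [/\ closed W, W 0 & forall (a : R[i]) u v, W u -> W v -> W (a *: u + v)].

Definition irreducible pi : Prop :=
  (exists v : V, v != 0) /\
  forall W : set V, closed_subspace W ->
    (forall g v, W v -> W (pi g v)) -> W = [set 0] \/ W = setT.

Definition fixed_vectors pi (K : set G) : set V :=
  [set v | forall g, K g -> pi g v = v].

(* [W] is a subspace here, so this is: spanned by at most [n] of its vectors. *)
Definition dim_le (W : set V) (n : nat) : Prop :=
  exists2 e : 'I_n -> V, (forall i, W (e i)) &
    forall v, W v -> exists c : 'I_n -> R[i], v = \sum_i c i *: e i.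

End Representations.

(* Main.v *)
Require Import Defs.
From mathcomp Require Import all_boot all_algebra all_classical all_reals all_analysis.
From mathcomp Require Import all_order complex ring lra.

(* Write K for Aut(T), H for the space of K-fixed vectors and P for the
   orthogonal projection onto H. Root T and let X be a branch at the root. Cutting
   an edge far from its defect, one sees that every spheromorphism lies in K l K
   with l supported on X. Let s in K be a translation along an axis through the
   root that avoids X, so that the translates of X under the powers of s are
   pairwise disjoint. For g and h supported on X, g commutes with s^d h s^-d for
   d >= 1. By von Neumann's mean ergodic theorem the Cesaro means of
   pi(s^d) pi(h) v, for v in H, converge to an s-fixed vector; it is fixed by the
   automorphisms supported away from either end of the axis, which together with s
   generate K (Mautner phenomenon), so the limit is P pi(h) v. Averaging the
   commutation relation gives P pi(g) P pi(h) P = P pi(h) P pi(g) P.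
   The operators P pi(g) P thus commute, and Schur's lemma, with the
   square root of a positive operator in place of the spectral theorem, shows that
   they act on H by scalars; irreducibility then leaves at most one dimension. *)

Set Implicit Arguments.
Unset Strict Implicit.
Unset Printing Implicit Defensive.

Import Order.TTheory GRing.Theory Num.Theory.
Import numFieldNormedType.Exports.

Local Open Scope classical_set_scope.

(** * Words and automorphisms of the tree *)

Section Words.
Implicit Types (a b u w : seq nat) (i j n c : nat).

(* Vertices are coded by the labels of the edges leading to them from the
   root, the edge at the root coming first. *)
Fixpoint wadj a b : bool := match a, b with
  | [::], [:: _] | [:: _], [::] => true
  | c :: a', d :: b' => (c == d) && wadj a' b'
  | _, _ => false end.

Definition branch i a := if a is c :: _ then c == i else false.

Lemma wadj_cons c d a b : wadj (c :: a) (d :: b) = (c == d) && wadj a b.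
Proof. by case: a b => [|x a] [|y b]. Qed.

Lemma wadj_sym : symmetric wadj.
Proof.
elim=> [|c a IH] [|d b] //; last by rewrite !wadj_cons eq_sym IH.
Qed.

Lemma wadj_rcons a n : wadj a (rcons a n).
Proof. by elim: a => // c a IH; rewrite rcons_cons wadj_cons eqxx. Qed.

Lemma wadjP a b : wadj a b <-> (exists n, a = rcons b n) \/ (exists n, b = rcons a n).
Proof.
split; last by move=> [] [n ->]; [rewrite wadj_sym|]; exact: wadj_rcons.
elim: a b => [|c a IH] [|d b] //; first by case: b => // _; right; exists d.
  by case: a IH => // _ _; left; exists c.
rewrite wadj_cons => /andP[/eqP -> /IH[[n ->]|[n ->]]]; first by left; exists n.
by right; exists n.
Qed.

Lemma wadj_nil b : wadj [::] b -> exists n, b = [:: n].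
Proof. by case: b => [|n []] // _; exists n. Qed.

Lemma wadj_branch i a b : wadj a b -> ~~ branch i a -> branch i b ->
  a = [::] /\ b = [:: i].
Proof.
case: a b => [|c a] [|d b] //; first by case: b => // _ _ /= /eqP ->.
by rewrite wadj_cons => /andP[/eqP <- _] /= /negbTE ->.
Qed.

Definition wauto (f : seq nat -> seq nat) :=
  bijective f /\ forall a b, wadj (f a) (f b) = wadj a b.

(* A translation along the axis ..., [:: 1; 0], [:: 1], [::], [:: 0],
   [:: 0; 0], ..., mapping the complement of branch 1 onto branch 0. *)
Definition shiftw a := match a with
  | [::] => [:: 0]
  | 1 :: [::] => [::]
  | 1 :: c :: u => c.+1 :: u
  | c :: u => 0 :: c.-1 :: u end.
Definition unshiftw a := match a with
  | [::] => [:: 1]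
  | 0 :: [::] => [::]
  | 0 :: c :: u => (if c is 0 then 0 else c.+1) :: u
  | c.+1 :: u => 1 :: c :: u end.

Lemma shiftwK : cancel shiftw unshiftw.
Proof. by case=> [|[|[|c]] [|[|d] u]]. Qed.
Lemma unshiftwK : cancel unshiftw shiftw.
Proof. by case=> [|[|c] [|[|d] u]]. Qed.

Lemma shiftw_auto : wauto shiftw.
Proof.
split; first by exists unshiftw; [exact: shiftwK|exact: unshiftwK].
case=> [|[|[|c]] [|e a]] [|[|[|d]] [|f b]] //=;
  rewrite ?andbF ?andbT //; first [by case: a | by case: b].
Qed.

Lemma shiftw_branch a : ~~ branch 1 a -> branch 0 (shiftw a).
Proof. by case: a => [|[|[|c]] [|d u]]. Qed.
Lemma unshiftw_branch a : ~~ branch 0 a -> branch 1 (unshiftw a).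
Proof. by case: a => [|[|[|c]] [|d u]]. Qed.

Lemma branch_neq i j a : i != j -> branch i a -> ~~ branch j a.
Proof. by case: a => // c u ij /= /eqP ->. Qed.

Lemma iter_shiftw_branch n a : ~~ branch 1 a -> branch 0 (iter n.+1 shiftw a).
Proof.
move=> ha; elim: n => [|n IH]; first exact: shiftw_branch.
by rewrite iterS; apply: shiftw_branch; exact: branch_neq IH.
Qed.
Lemma iter_unshiftw_branch n a : ~~ branch 0 a -> branch 1 (iter n.+1 unshiftw a).
Proof.
move=> ha; elim: n => [|n IH]; first exact: unshiftw_branch.
by rewrite iterS; apply: unshiftw_branch; exact: branch_neq IH.
Qed.

(** In branch 1 each shift deletes one letter, so after at most [size a] steps the vertex has left
    that branch; the next step puts it into branch 0, where it stays. *)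
Lemma iter_shiftw_size n a : size a < n -> branch 0 (iter n shiftw a).
Proof.
elim: n a => // n IH a.
have [b1|b1 _] := boolP (branch 1 a); last exact: iter_shiftw_branch.
by rewrite iterSr => sa; apply: IH; case: a b1 sa => [|[|[|c]] [|d u]].
Qed.

Definition swapn i j c := if c == i then j else if c == j then i else c.
Definition swapw i j a := if a is c :: u then swapn i j c :: u else [::].

Lemma swapnK i j : involutive (swapn i j).
Proof. by move=> c; rewrite /swapn; do ![case: eqP => //]; congruence. Qed.
Lemma swapwK i j : involutive (swapw i j).
Proof. by case=> //= c u; rewrite swapnK. Qed.
Lemma swapw_auto i j : wauto (swapw i j).
Proof.
split; first by exists (swapw i j); exact: swapwK.
move=> [|c a] [|d b] //.
rewrite -[LHS]/(wadj (swapn i j c :: a) (swapn i j d :: b)).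
by rewrite !wadj_cons (inj_eq (inv_inj (swapnK i j))).
Qed.

(** Adjacent words other than the root share their first letter, so a walk avoiding the root stays
    in one branch. *)
Lemma branch_map (f : seq nat -> seq nat) i j : f [:: i] = [:: j] ->
  (forall u n, wadj (f (i :: u)) (f (i :: rcons u n))) ->
  (forall u, f (i :: u) <> [::]) -> forall u, branch j (f (i :: u)).
Proof.
move=> fi fa f0; elim/last_ind => [|u n IH]; first by rewrite fi /= eqxx.
case: (f (i :: u)) IH (fa u n) => // c w /= /eqP <-.
case: (f _) (f0 (rcons u n)) => // d w' _.
by rewrite -/(wadj (_ :: _) (_ :: _)) wadj_cons eq_sym => /andP[].
Qed.

(** The branch is tied to its complement only by the edge from the root to [[:: i]]. Since [f] fixes
    this edge, the identity on the branch glues with [f] off it, even if [f] breaks adjacency inside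
    the branch. *)
Lemma branch_surgery (f f' : seq nat -> seq nat) i :
  cancel f f' -> cancel f' f -> f [::] = [::] -> f [:: i] = [:: i] ->
  (forall a b, ~~ branch i a -> wadj (f a) (f b) = wadj a b) ->
  wauto (fun a => if branch i a then a else f a).
Proof.
move=> fK f'K f0 fi fa; have fI := can_inj fK.
have fN a : ~~ branch i a -> ~~ branch i (f a).
  case: a => [|c u] /=; first by rewrite f0.
  move=> ci; have /wadj_nil[j fc] : wadj [::] (f [:: c]) by rewrite -{1}f0 fa.
  have ji : j != i.
    apply: contraNneq ci => ji; rewrite ji -fi in fc.
    by have [->] := fI _ _ fc.
  apply: branch_neq ji _; apply: branch_map => //.
    by move=> w n; rewrite fa // wadj_cons eqxx wadj_rcons.
  by move=> w; rewrite -f0 => /fI.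
(* If [f'] sent a child of [u] into the branch, that edge would become the one from the root to
   [[:: i]], whose ends [f] fixes. *)
have f'N a : ~~ branch i a -> ~~ branch i (f' a).
  elim/last_ind: a => [|u n IH] h; first by rewrite -f0 fK.
  have /IH hu : ~~ branch i u by case: (u) h.
  apply/negP => hb; have : wadj (f' u) (f' (rcons u n)).
    by rewrite -fa // !f'K wadj_rcons.
  move=> /wadj_branch /(_ hu hb)[_ e].
  by move: h; rewrite -(f'K (rcons u n)) e fi /= eqxx.
split.
  exists (fun a => if branch i a then a else f' a) => a /=;
    (have [h|h] := boolP (branch i a); first by rewrite h).
    by rewrite (negbTE (fN _ h)) fK.
  by rewrite (negbTE (f'N _ h)) f'K.
have mixed a b : ~~ branch i a -> branch i b -> wadj (f a) b = wadj a b.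
  move=> ha hb; apply/idP/idP => h.
    have [fa0 ->] := wadj_branch h (fN _ ha) hb.
    by have -> : a = [::] by apply: fI; rewrite fa0.
  by have [-> ->] := wadj_branch h ha hb; rewrite f0.
move=> a b; case: ifPn => ha; case: ifPn => hb //; [|exact: mixed|exact: fa].
by rewrite wadj_sym mixed // wadj_sym.
Qed.

End Words.

Definition conjX (G : groupType) (s : G) d (h : G) : G := (s ^+ d * h * s ^- d)%g.

(** The coding of [code_exists] grows words at the head; reversal puts the edge at the root first,
    as [wadj] expects. *)
Lemma tree_coding (T : inftree) : exists (e : T -> seq nat) (e' : seq nat -> T),
  [/\ cancel e e', cancel e' e & forall x y, wadj (e x) (e y) = adj x y].
Proof.
have [|v [[_ vI vs] va]] := code_exists (subtreeT T).
  by move=> x _; apply: sub_infinite_set (@adj_infinite T x) => y.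
have /choice[c cP] : forall x, exists s, v s = x.
  by move=> x; have [s _ <-] := vs x I; exists s.
have cK s : c (v s) = s by apply: vI; rewrite ?in_setT ?cP.
exists (rev \o c), (v \o rev); split=> [x|s|x y] /=; rewrite ?revK ?cK ?revK ?cP //.
have revE s t : (exists n, rev s = rcons (rev t) n) <-> (exists n, s = n :: t).
  split=> [] [n h]; exists n; last by rewrite h rev_cons.
  by rewrite -(revK s) h rev_rcons revK.
rewrite -{2}(cP x) -{2}(cP y); apply/idP/idP.
  by move=> /wadjP[/revE h|/revE h]; apply/va; [left|right].
by move=> /va[/revE h|/revE h]; apply/wadjP; [left|right].
Qed.

(** * Generation of the automorphism group and the double coset decomposition *)

Section TreeGroup.
Variables (T : inftree) (e : T -> seq nat) (e' : seq nat -> T).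
Hypotheses (eK : cancel e e') (e'K : cancel e' e).
Hypothesis e_adj : forall x y, wadj (e x) (e y) = adj x y.
Implicit Types (g h k t : hier T) (a b u w : seq nat) (i j n d : nat).

Definition onwords g a := e (g (e' a)).
Local Notation W := onwords.

Lemma onwordsM g h a : W (g * h)%g a = W g (W h a).
Proof. by rewrite /onwords hierM eK. Qed.
Lemma onwords1 a : W 1%g a = a.
Proof. by rewrite /onwords /= e'K. Qed.
Lemma onwordsK g : cancel (W g) (W g^-1%g).
Proof. by move=> a; rewrite -onwordsM mulVg onwords1. Qed.
Lemma onwordsVK g : cancel (W g^-1%g) (W g).
Proof. by move=> a; rewrite -onwordsM mulgV onwords1. Qed.
Lemma onwords_inj g h : W g =1 W h -> g = h.
Proof.
move=> gh; apply: hier_eq => x; apply: (can_inj eK).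
by have := gh (e x); rewrite /onwords eK.
Qed.
Lemma onwordsX g n a : W (g ^+ n)%g a = iter n (W g) a.
Proof. by elim: n => [|n IH]; rewrite ?onwords1 // expgS onwordsM IH. Qed.

Lemma AutP g : Aut T g <-> forall a b, wadj (W g a) (W g b) = wadj a b.
Proof.
split=> [[_ ga] a b|ga]; first by rewrite e_adj ga -e_adj !e'K.
split; first exact: (hierP g).1.
by move=> x y; have := ga (e x) (e y); rewrite /onwords !eK !e_adj.
Qed.

Lemma AutM g h : Aut T g -> Aut T h -> Aut T (g * h)%g.
Proof. by move=> /AutP ga /AutP ha; apply/AutP => a b; rewrite !onwordsM ga. Qed.
Lemma AutV g : Aut T g -> Aut T g^-1%g.
Proof. by move=> /AutP ga; apply/AutP => a b; rewrite -ga !onwordsVK. Qed.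

Lemma wauto_Aut f : wauto f -> exists2 g, Aut T g & W g =1 f.
Proof.
move=> [[f' fK f'K] fa]; pose F x := e' (f (e x)).
have autF : automorphism F.
  split; first by exists (fun x => e' (f' (e x))) => x; rewrite /F e'K ?fK ?f'K eK.
  by move=> x y; rewrite -e_adj /F !e'K fa e_adj.
by exists (Hier (automorphism_spheromorphism autF)) => // a; rewrite /onwords /F /= !e'K.
Qed.

Lemma onwords_defect g : exists s : seq (seq nat), forall a b,
  a \notin s -> wadj (W g a) (W g b) = wadj a b.
Proof.
have [_ fD] := (spheromorphismP g).1 (hierP g).
have /finite_seqP[s sE] : finite_set (e @` ends (defect g)).
  by apply: finite_image; exact: finite_ends.
exists s => a b as'; apply/eqP; apply: contraNT as' => ne.
have : [set` s] a => //; rewrite -sE; exists (e' a); last exact: e'K.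
left; exists (e' a, e' b) => //.
by rewrite /defect /= -!e_adj !e'K.
Qed.

(** Each of the two permutes the set on which the other is the identity. *)
Lemma disjoint_commute (A : pred (seq nat)) g h :
  (forall a, A a -> W g a = a) -> (forall a, ~~ A a -> W h a = a) -> (g * h = h * g)%g.
Proof.
move=> gA hA; apply: onwords_inj => a; rewrite !onwordsM.
have [Aa|Aa] := boolP (A a).
  rewrite (gA a) // gA //; apply: contraT => /[dup] + /hA /(can_inj (onwordsK h)) ha.
  by rewrite ha Aa.
rewrite (hA a) // hA //; apply: contraNN Aa => /[dup] Ag /gA /(can_inj (onwordsK g)) ga.
by rewrite -ga.
Qed.

Variable s : hier T.
Hypothesis Ws : W s =1 shiftw.

Lemma WsV : W s^-1%g =1 unshiftw.
Proof. by move=> a; rewrite -{1}(unshiftwK a) -Ws onwordsK. Qed.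

(* The branch X of the introduction is branch 2, off the axis of [shiftw]. *)
Definition local_part : set (hier T) := [set g | forall a, ~~ branch 2 a -> W g a = a].
Local Notation L := local_part.

(** The conjugate is supported on the image of branch 2 under a power of [s]. Branch 2 avoids branch
    1, so this image lies in branch 0 as soon as the exponent is positive, hence [d.+1]. *)
Lemma conjX_fixed d g a : L g -> ~~ branch 0 a -> W (conjX s d.+1 g) a = a.
Proof.
move=> Lg a0; rewrite /conjX !onwordsM Lg ?onwordsVK //.
apply: contra a0 => h; rewrite -(onwordsVK (s ^+ d.+1)%g a) onwordsX.
rewrite (eq_iter Ws); apply: iter_shiftw_branch; exact: branch_neq h.
Qed.

Lemma conjXV_fixed d g a : L g -> ~~ branch 1 a -> W (conjX s^-1%g d.+1 g) a = a.
Proof.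
move=> Lg a0; rewrite /conjX !onwordsM Lg ?onwordsVK //.
apply: contra a0 => h; rewrite -(onwordsVK (s^-1 ^+ d.+1)%g a) onwordsX.
rewrite (eq_iter WsV); apply: iter_unshiftw_branch; exact: branch_neq h.
Qed.

Lemma local_conjX_comm g h d : L g -> L h -> (g * conjX s d.+1 h = conjX s d.+1 h * g)%g.
Proof.
move=> Lg Lh; apply: (@disjoint_commute (fun a => ~~ branch 2 a)) => //.
by move=> a /negPn a2; apply: conjX_fixed => //; exact: branch_neq a2.
Qed.

(** Exchanging the first letter with 1 and then shifting shortens a word by one letter. [D] is
    abstract so as to serve both for [Aut T] and for the automorphisms lying in a given set. *)
Lemma root_transitive (D : set (hier T)) :
  (forall g h, D g -> D h -> D (g * h)%g) -> D 1%g -> D s ->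
  (forall i j, exists2 g, D g & W g =1 swapw i j) ->
  forall a, exists2 g, D g & W g a = [::].
Proof.
move=> DM D1 Ds Dsw a; have [n] := ubnP (size a); elim: n a => // n IH [|c u] hn.
  by exists 1%g => //; rewrite onwords1.
have [g Dg gE] := Dsw c 1; have [|k Dk kE] := IH (shiftw (1 :: u)).
  by case: u hn.
exists (k * (s * g))%g; first by apply: (DM) => //; exact: DM.
by rewrite !onwordsM gE /= /swapn eqxx Ws.
Qed.

(** Swaps and [s] reduce the claim to an automorphism [f] fixing the root and [[:: 0]]. Such an [f]
    is a product of two factors, one trivial on branch 0, the other trivial off branch 0 and hence
    on branch 1. *)
Lemma Aut_generated (D : set (hier T)) :
  (forall g h, D g -> D h -> D (g * h)%g) -> (forall g, D g -> D g^-1%g) -> D s ->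
  (forall t, Aut T t -> (forall a, branch 0 a -> W t a = a) -> D t) ->
  (forall t, Aut T t -> (forall a, branch 1 a -> W t a = a) -> D t) ->
  Aut T `<=` D.
Proof.
move=> DM DV Ds D0 D1.
have Done : D 1%g by rewrite -(mulgV s); apply: DM => //; exact: DV.
have swD n i j : (n == 0) || (n == 1) -> n != i -> n != j ->
    exists2 g, D g & W g =1 swapw i j.
  move=> n01 ni nj; have [g Ag gE] := wauto_Aut (swapw_auto i j).
  exists g => //; have gn a : branch n a -> W g a = a.
    by case: a => // c u /= /eqP ->; rewrite gE /= /swapn (negbTE ni) (negbTE nj).
  by case/orP: n01 gn => /eqP -> gn; [exact: D0|exact: D1].
have sw01 : exists2 g, D g & W g =1 swapw 0 1.
  have [g Dg gE] := @swD 1 0 2 isT isT isT; have [h Dh hE] := @swD 0 1 2 isT isT isT.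
  exists (g * (h * g))%g; first by apply: (DM) => //; exact: DM.
  by move=> a; rewrite !onwordsM !gE hE; case: a => [|[|[|[|c]]] u].
have sw10 : exists2 g, D g & W g =1 swapw 1 0.
  have [g Dg gE] := sw01; exists g => // a; rewrite gE; by case: a => [|[|[|c]] u].
have sw_id i : exists2 g, D g & W g =1 swapw i i.
  exists 1%g => // a; rewrite onwords1; case: a => // c u /=; rewrite /swapn.
  by case: eqP => // ->.
have Dsw i j : exists2 g, D g & W g =1 swapw i j.
  have [<-|ij] := eqVneq i j; first exact: sw_id.
  case: i j ij => [|[|i]] [|[|j]] // ij; by [apply: (@swD 0)|apply: (@swD 1)].
(* Elements of [D] need not be automorphisms, but the correcting factors [r] and [q] must be for [f]
   to be one. *)
have DAM g h : (D `&` Aut T) g -> (D `&` Aut T) h -> (D `&` Aut T) (g * h)%g.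
  by move=> [Dg Ag] [Dh Ah]; split; [exact: DM|exact: AutM].
have DA1 : (D `&` Aut T) 1%g by split => //; apply/AutP => a b; rewrite !onwords1.
have DAs : (D `&` Aut T) s by split => //; apply/AutP => a b; rewrite !Ws shiftw_auto.2.
have DAsw i j : exists2 g, (D `&` Aut T) g & W g =1 swapw i j.
  have [g Dg gE] := Dsw i j; exists g => //; split => //.
  by apply/AutP => a b; rewrite !gE (swapw_auto i j).2.
move=> t At; have [r [Dr Ar] rE] := root_transitive DAM DA1 DAs DAsw (W t [::]).
have [z tz] : exists z, W (r * t)%g [:: 0] = [:: z].
  have := (AutP _).1 (AutM Ar At) [::] [:: 0].
  by rewrite (onwordsM r t [::]) rE; exact: wadj_nil.
have [q [Dq Aq] qE] := DAsw z 0.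
pose f := (q * (r * t))%g; have Af : Aut T f by do 2!apply: AutM => //.
have f0 : W f [::] = [::] by rewrite 2!onwordsM rE qE.
have fi : W f [:: 0] = [:: 0] by rewrite onwordsM tz qE /= /swapn eqxx.
have [k Ak kE] := wauto_Aut (branch_surgery (onwordsK f) (onwordsVK f) f0 fi
  (fun a b _ => (AutP f).1 Af a b)).
have Dk : D k by apply: D0 => // a a0; rewrite kE a0.
have Db : D (f * k^-1)%g.
  apply: D1 => [|a a1]; first by apply: AutM => //; exact: AutV.
  have a0 := branch_neq (isT : 1 != 0) a1.
  have a0' : ~~ branch 0 (W k^-1%g a).
    by apply: contra a0 => h; rewrite -(onwordsVK k a) kE h.
  by have := kE (W k^-1%g a); rewrite (negbTE a0') onwordsVK onwordsM.
have -> : t = (r^-1 * (q^-1 * (f * k^-1 * k)))%g by rewrite mulgVK !mulKg.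
do 2!(apply: (DM); first exact: DV); exact: DM.
Qed.

Lemma edge_transitive a b : wadj a b ->
  exists g, [/\ Aut T g, W g a = [::] & W g b = [:: 2]].
Proof.
move=> ab; have AutSw i j : exists2 g, Aut T g & W g =1 swapw i j.
  exact: wauto_Aut (swapw_auto i j).
have As : Aut T s by apply/AutP => c d; rewrite !Ws shiftw_auto.2.
have A1 : Aut T 1%g by apply/AutP => c d; rewrite !onwords1.
have [r Ar ra] := root_transitive AutM A1 As AutSw a.
have [z rb] : exists z, W r b = [:: z].
  by have := (AutP r).1 Ar a b; rewrite ra ab; exact: wadj_nil.
have [g Ag gE] := AutSw z 2; exists (g * r)%g; split; first exact: AutM.
  by rewrite onwordsM ra gE.
by rewrite onwordsM rb gE /= /swapn eqxx.
Qed.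

(** Composing with [k^-1] on the right moves the defect of [g] into branch 2, and [m] on the left
    restores the edge from the root to [[:: 2]]. Off branch 2 the result [f] agrees with an
    automorphism [h], so [h^-1 * f] is supported on branch 2. *)
Lemma local_decomposition g : exists k1 k2 l,
  [/\ Aut T k1, Aut T k2, L l & g = (k1 * l * k2)%g].
Proof.
have As : Aut T s by apply/AutP => c d; rewrite !Ws shiftw_auto.2.
have [ds dsP] := onwords_defect g.
have [r Ar rE] := wauto_Aut (swapw_auto 0 2).
(* The exponent must exceed every length strictly: [s ^+ n] then puts the exceptional words into
   branch 0, and [r] carries them to branch 2. *)
pose n := (\max_(a <- ds) size a).+1.
have sn d : Aut T (s ^+ d)%g.
  by apply/AutP => c b; rewrite !onwordsX; elim: d => //= d IH; rewrite ((AutP s).1 As).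
pose k := (r * s ^+ n)%g; have Ak : Aut T k by exact: AutM.
have kds a : a \in ds -> branch 2 (W k a).
  move=> ad; rewrite onwordsM rE onwordsX (eq_iter Ws).
  have : branch 0 (iter n shiftw a).
    by apply: iter_shiftw_size; rewrite ltnS; exact: leq_bigmax_seq.
  by case: (iter n shiftw a) => // c u /= /eqP ->.
have gk a b : ~~ branch 2 a -> wadj (W (g * k^-1)%g a) (W (g * k^-1)%g b) = wadj a b.
  move=> a2; rewrite !onwordsM dsP ?((AutP _).1 (AutV Ak)) //.
  by apply: contra a2 => /kds; rewrite onwordsVK.
have [m [Am m0 m2]] := edge_transitive (gk [::] [:: 2] isT).
pose f := (m * (g * k^-1))%g.
have [h Ah hE] : exists2 h, Aut T h & W h =1 (fun a => if branch 2 a then a else W f a).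
  apply: wauto_Aut; apply: (branch_surgery (onwordsK f) (onwordsVK f)).
  - by rewrite /f onwordsM.
  - by rewrite /f onwordsM.
  - by move=> a b a2; rewrite /f !(onwordsM m) ((AutP m).1 Am) gk.
exists (m^-1 * h)%g, k, (h^-1 * f)%g; split => //.
- by apply: AutM => //; exact: AutV.
- move=> a a2; rewrite onwordsM; apply: (can_inj (onwordsK h)).
  by rewrite onwordsVK hE (negbTE a2).
- by clearbody k; rewrite /f !mulgA mulgK mulVg mul1g mulgVK.
Qed.

End TreeGroup.

(** * Hilbert spaces *)

Local Open Scope ring_scope.

Local Notation Re := complex.Re.

Section Hilbert.
Variables (R : realType) (V : hilbertType R).
Implicit Types (u v w x y : V) (a : R[i]) (r : R).

(* A complex subspace has the same orthogonal complement for the real inner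
   product [rip] as for [inner]. *)
Definition rip u v : R := Re (inner V u v).
Definition rnorm u : R := Re `|u|.

Lemma normE u : `|u| = (rnorm u)%:C%C.
Proof. by rewrite /rnorm RRe_real // ger0_real. Qed.
Lemma rnorm_ge0 u : 0 <= rnorm u.
Proof. by rewrite -ler0c -normE. Qed.
Lemma rnorm0 : rnorm 0 = 0.
Proof. by rewrite /rnorm normr0. Qed.
Lemma rnorm_eq0 u : rnorm u = 0 -> u = 0.
Proof. by move=> h; apply/eqP; rewrite -normr_eq0 normE h. Qed.
Lemma rnormD u v : rnorm (u + v) <= rnorm u + rnorm v.
Proof. by rewrite -lecR rmorphD /= -!normE ler_normD. Qed.
Lemma rnormN u : rnorm (- u) = rnorm u.
Proof. by rewrite /rnorm normrN. Qed.
Lemma rnormC u v : rnorm (u - v) = rnorm (v - u).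
Proof. by rewrite -rnormN opprB. Qed.
Lemma rnormZ r u : rnorm (r%:C%C *: u) = `|r| * rnorm u.
Proof.
apply: complexI; rewrite rmorphM /= -!normE normrZ normc_def /=; congr (_ * _).
by rewrite expr0n addr0 sqrtr_sqr.
Qed.

Lemma ripDl u v w : rip (u + v) w = rip u w + rip v w.
Proof. by rewrite /rip linearDl raddfD. Qed.
Lemma ripDr u v w : rip w (u + v) = rip w u + rip w v.
Proof. by rewrite /rip linearDr raddfD. Qed.
Lemma ripNl u v : rip (- u) v = - rip u v.
Proof. by rewrite /rip linearNl raddfN. Qed.
Lemma ripNr u v : rip v (- u) = - rip v u.
Proof. by rewrite /rip linearNr raddfN. Qed.
Lemma ripBl u v w : rip (u - v) w = rip u w - rip v w.
Proof. by rewrite ripDl ripNl. Qed.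
Lemma ripBr u v w : rip w (u - v) = rip w u - rip w v.
Proof. by rewrite ripDr ripNr. Qed.
Lemma rip0l u : rip 0 u = 0.
Proof. by rewrite /rip linear0l. Qed.
Lemma rip0r u : rip u 0 = 0.
Proof. by rewrite /rip linear0r. Qed.
Lemma ripC u v : rip u v = rip v u.
Proof.
have reJ (z : R[i]) : Re z = Re (Num.conj z) by case: z.
by rewrite /rip hermC expr0 mul1r -reJ.
Qed.
Lemma ripZ a u v : rip (a *: u) v = rip u (a^*%C *: v).
Proof.
rewrite /rip linearZl_LR linearZr_LR /=; congr (Re (_ * _)).
by rewrite -[LHS]conjcK.
Qed.
Lemma ripZl r u v : rip (r%:C%C *: u) v = r * rip u v.
Proof.
have ReM (z : R[i]) : Re (r%:C%C * z) = r * Re z.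
  by case: z => a b; rewrite /= mul0r subr0.
by rewrite /rip linearZl_LR ReM.
Qed.
Lemma ripZr r u v : rip u (r%:C%C *: v) = r * rip u v.
Proof. by rewrite ripC ripZl ripC. Qed.
Lemma rnorm2 u : rnorm u ^+ 2 = rip u u.
Proof. by rewrite /rip -inner_norm normE -rmorphXn. Qed.
Lemma rip_ge0 u : 0 <= rip u u.
Proof. by rewrite -rnorm2 sqr_ge0. Qed.
Lemma rip_eq0 u : rip u u = 0 -> u = 0.
Proof. by rewrite -rnorm2 => /eqP; rewrite sqrf_eq0 => /eqP /rnorm_eq0. Qed.
Lemma rnorm_le u v : (rnorm u <= rnorm v) = (rip u u <= rip v v).
Proof. by rewrite -!rnorm2 ler_sqr // nnegrE rnorm_ge0. Qed.

(** With p, q the norms of [u], [v], expanding the square of the norm of q u - p v gives 2 p q (p q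
    - rip u v) >= 0. *)
Lemma rip_CS u v : rip u v <= rnorm u * rnorm v.
Proof.
have := rip_ge0 ((rnorm v)%:C%C *: u - (rnorm u)%:C%C *: v).
rewrite !(ripBl, ripBr, ripZl, ripZr) (ripC v u) -!rnorm2.
move: (rnorm_ge0 u) (rnorm_ge0 v); set p := rnorm u; set q := rnorm v.
set c := rip u v => hp hq h.
have [p0|p0] := eqVneq p 0; first by rewrite /c (rnorm_eq0 p0) rip0l mulr_ge0.
have [q0|q0] := eqVneq q 0; first by rewrite /c (rnorm_eq0 q0) rip0r mulr_ge0.
have pq : 0 < p * q by rewrite mulr_gt0 // lt_def ?p0 ?q0.
rewrite -(ler_pM2l pq); nra.
Qed.
Lemma rip_abs u v : `|rip u v| <= rnorm u * rnorm v.
Proof.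
by rewrite ler_norml rip_CS andbT lerNl -ripNl -(rnormN u) rip_CS.
Qed.

(** Convergence with real tolerances, the norm of [V] being valued in [R[i]]. *)
Definition scvg (u : nat -> V) w :=
  forall e, 0 < e -> exists n0, forall n, (n0 <= n)%N -> rnorm (u n - w) < e.

Lemma scvg_cvg (u : nat -> V) w : scvg u w <-> u @ \oo --> w.
Proof.
split=> [h|/cvgr_dist_lt h e e0].
  apply/cvgrPdist_lt => e e0; have er : e = (Re e)%:C%C by rewrite RRe_real // gtr0_real.
  have [|n0 n0P] := h (Re e); first by rewrite -ltcR -er.
  exists n0 => // n /= /n0P; rewrite distrC normE er ltcR; exact.
have /h[n0 _ n0P] : 0 < e%:C%C by rewrite ltcR.
by exists n0 => n /n0P /=; rewrite normE ltcR rnormC.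
Qed.

Lemma closed_scvg (W : set V) (u : nat -> V) w :
  closed W -> (forall n, W (u n)) -> scvg u w -> W w.
Proof.
move=> cW uW /scvg_cvg uw; apply: (closed_cvg W cW _ _ uw); exact: nearW.
Qed.

Lemma scvg_closed (W : set V) :
  (forall (u : nat -> V) w, (forall n, W (u n)) -> scvg u w -> W w) -> closed W.
Proof.
move=> h w clw.
have /choice[u uP] : forall n : nat, exists x, W x /\ rnorm (x - w) < n.+1%:R^-1.
  move=> n; have [|x [Wx /= xb]] := clw (ball w (n.+1%:R^-1)%:C%C).
    by apply: nbhsx_ballx; rewrite ltcR invr_gt0.
  by exists x; split=> //; move: xb; rewrite -ball_normE /= normE ltcR rnormC.
apply: (h u) => [n|e e0]; first exact: (uP n).1.
have [n _ nP] := near_infty_natSinv_lt (PosNum e0).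
by exists n => m /nP /= ; apply: lt_trans; exact: (uP m).2.
Qed.

Lemma scvg_complete (u : nat -> V) :
  (forall e, 0 < e -> exists n0, forall m n,
    (n0 <= m)%N -> (n0 <= n)%N -> rnorm (u m - u n) < e) ->
  exists w, scvg u w.
Proof.
move=> h; have : cvg (u @ \oo).
  apply/cauchy_cvgP/cauchyP => e e0.
  have er : e = (Re e)%:C%C by rewrite RRe_real // gtr0_real.
  have [|n0 n0P] := h (Re e); first by rewrite -ltcR -er.
  exists (u n0); exists n0 => // n /= nn.
  by rewrite -ball_normE /= normE er ltcR n0P.
by move=> uc; exists (lim (u @ \oo)); apply/scvg_cvg.
Qed.

Lemma rnorm_small u : (forall e, 0 < e -> rnorm u < e) -> u = 0.
Proof.
move=> h; apply: rnorm_eq0; apply/eqP; rewrite eq_le rnorm_ge0 andbT leNgt.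
by apply/negP => /h; rewrite ltxx.
Qed.

Lemma scvg_uniq (u : nat -> V) w w' : scvg u w -> scvg u w' -> w = w'.
Proof.
move=> h h'; apply/eqP; rewrite -subr_eq0; apply/eqP/rnorm_small => e e0.
have e2 : 0 < e / 2 by lra.
have [n nP] := h _ e2; have [m mP] := h' _ e2.
have := nP (maxn n m) (leq_maxl _ _); have := mP (maxn n m) (leq_maxr _ _).
have := rnormD (w - u (maxn n m)) (u (maxn n m) - w').
rewrite (rnormC w) addrA subrK; lra.
Qed.

End Hilbert.

(** * Orthogonal projections and bounded operators *)

Section Projection.
Variables (R : realType) (V : hilbertType R).
Implicit Types (u v w x y : V) (a : R[i]) (r : R).

Lemma natSinv_small (e : R) : 0 < e ->
  exists n0, forall n, (n0 <= n)%N -> n.+1%:R^-1 < e.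
Proof.
by move=> e0; have [n0 _ h] := near_infty_natSinv_lt (PosNum e0); exists n0.
Qed.

Lemma closed_subspaceD (W : set V) u v : closed_subspace W -> W u -> W v -> W (u + v).
Proof. by move=> [_ _ h] Wu Wv; rewrite -[u]scale1r; exact: h. Qed.
Lemma closed_subspaceZ (W : set V) a u : closed_subspace W -> W u -> W (a *: u).
Proof. by move=> [_ W0 h] Wu; rewrite -[_ *: _]addr0; exact: h. Qed.
Lemma closed_subspaceB (W : set V) u v : closed_subspace W -> W u -> W v -> W (u - v).
Proof.
move=> cW Wu Wv; apply: closed_subspaceD => //.
by rewrite -scaleN1r; exact: closed_subspaceZ.
Qed.

Lemma nearest_point (W : set V) v : closed_subspace W ->
  exists2 w, W w & forall x, W x -> rip (v - w) (v - w) <= rip (v - x) (v - x).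
Proof.
move=> cW; have [clW W0 _] := cW.
pose D := [set rip (v - x) (v - x) | x in W].
have iD : has_inf D.
  split; first by exists (rip (v - 0) (v - 0)); exists 0.
  by exists 0 => _ [x _ <-]; exact: rip_ge0.
have dD x : W x -> inf D <= rip (v - x) (v - x).
  by move=> Wx; apply: ge_inf; [case: iD|exists x].
have d0 : 0 <= inf D.
  by apply: lb_le_inf; [case: iD|move=> _ [x _ <-]; exact: rip_ge0].
set d := inf D in dD d0.
have /choice[u uP] : forall n : nat,
    exists w, W w /\ rip (v - w) (v - w) < d + n.+1%:R^-1.
  move=> n; have e0 : 0 < n.+1%:R^-1 :> R by rewrite invr_gt0.
  by have [_ [w Ww <-] wd] := inf_adherent e0 iD; exists w; split; [|exact: wd].
(* Parallelogram law: the midpoint of [x] and [y] lies in [W], at squared distance at least [d] from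
   [v]. It makes the minimizing sequence Cauchy. *)
have para x y : W x -> W y ->
    rip (x - y) (x - y) <= 2 * rip (v - x) (v - x) + 2 * rip (v - y) (v - y) - 4 * d.
  move=> Wx Wy; have := dD (2^-1%:C%C *: (x + y)); rewrite /d.
  move=> /(_ (closed_subspaceZ _ cW (closed_subspaceD cW Wx Wy))).
  rewrite !(ripBl, ripBr, ripDl, ripDr, ripZl, ripZr) (ripC y x) (ripC v x) (ripC v y).
  lra.
have [w uw] : exists w, scvg u w.
  apply: scvg_complete => e e0.
  have [|n0 n0P] := @natSinv_small (e ^+ 2 / 4).
    by rewrite divr_gt0 // exprn_gt0.
  exists n0 => m n /n0P hm /n0P hn.
  rewrite -(@ltr_pXn2r _ 2) ?nnegrE ?rnorm_ge0 ?(ltW e0) // rnorm2.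
  have := para _ _ (uP m).1 (uP n).1; have := (uP m).2; have := (uP n).2.
  move: hm hn; move: (m.+1%:R^-1) (n.+1%:R^-1) => k l; lra.
have Ww : W w by apply: (closed_scvg clW _ uw) => n; exact: (uP n).1.
exists w => // x Wx; apply: le_trans (dD x Wx).
rewrite leNgt; apply/negP => dlt.
pose p := rnorm (v - w); pose q := Num.sqrt d.
have q0 : 0 <= q by exact: sqrtr_ge0.
have q2 : q ^+ 2 = d by rewrite sqr_sqrtr.
have qp : q < p by rewrite -(@ltr_pXn2r _ 2) ?nnegrE ?rnorm_ge0 // q2 rnorm2.
(* If q < p, some term of the sequence is within (p + q) / 2 of [v] and within (p - q) / 2 of [w],
   against the triangle inequality. *)
have [|n1 h1] := @natSinv_small (((p + q) / 2) ^+ 2 - d).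
  by have : 0 < (p - q) * (p + 3 * q) by [apply: mulr_gt0; lra]; rewrite -q2; lra.
have [|n2 h2] := uw ((p - q) / 2); first by lra.
have := h1 _ (leq_maxl n1 n2); have := h2 _ (leq_maxr n1 n2).
have [_] := uP (maxn n1 n2).
move: (u (maxn n1 n2)) => z hz hzw hn.
have : rnorm (v - z) < (p + q) / 2.
  rewrite -(@ltr_pXn2r _ 2) ?nnegrE ?rnorm_ge0 //; last by lra.
  by rewrite rnorm2; apply: lt_trans hz _; rewrite -ltrBrDl.
have := rnormD (v - z) (z - w); rewrite addrA subrK -/p; lra.
Qed.

Lemma orth_exists (W : set V) v : closed_subspace W ->
  exists2 w, W w & forall x, W x -> rip (v - w) x = 0.
Proof.
move=> cW; have [w Ww wP] := nearest_point v cW; exists w => // x Wx.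
set b := rip _ _; pose c := rip x x; have c0 : 0 <= c by exact: rip_ge0.
(* Moving [w] by t x cannot reduce the distance, so 2 t b <= t^2 c. Dividing by c + 1 rather than c
   allows x = 0 and leaves t^2 (c + 2) <= 0. *)
have := wP (w + (b / (c + 1))%:C%C *: x).
move=> /(_ (closed_subspaceD cW Ww (closed_subspaceZ _ cW Wx))).
rewrite opprD addrA !(ripBl (v - w), ripBr (v - w), ripZl, ripZr) (ripC x) -/b -/c.
set t := b / (c + 1) => h.
have tE : t * (c + 1) = b by rewrite divfK // gt_eqF //; lra.
rewrite -tE in h *. have h2 : t ^+ 2 * (c + 2) <= 0 by lra.
have : t ^+ 2 <= 0 by rewrite -(@pmulr_lle0 _ (c + 2)) //; lra.
by rewrite le_eqVlt ltNge sqr_ge0 orbF sqrf_eq0 => /eqP ->; rewrite mul0r.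
Qed.

Definition blin (A : V -> V) := [/\ forall u v, A (u + v) = A u + A v,
  forall a u, A (a *: u) = a *: A u &
  exists2 M, 0 <= M & forall u, rnorm (A u) <= M * rnorm u].

Lemma blinB A u v : blin A -> A (u - v) = A u - A v.
Proof. by move=> [hD hZ _]; rewrite hD -scaleN1r hZ scaleN1r. Qed.
Lemma blin0 A : blin A -> A 0 = 0.
Proof. by move=> h; have := blinB 0 0 h; rewrite !subrr. Qed.

Lemma scvg_blin A (u : nat -> V) w : blin A -> scvg u w -> scvg (A \o u) (A w).
Proof.
move=> bA uw e e0; have [_ _ [M M0 hM]] := bA.
have M1 : 0 < M + 1 by rewrite ltr_wpDl.
have [|n0 n0P] := uw (e / (M + 1)); first exact: divr_gt0.
exists n0 => n /n0P h /=; rewrite -blinB //.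
apply: le_lt_trans (hM _) _.
have : (M + 1) * rnorm (u n - w) < e.
  by rewrite mulrC -ltr_pdivlMr.
by have := rnorm_ge0 (u n - w); lra.
Qed.

Lemma scvgD (u u' : nat -> V) w w' : scvg u w -> scvg u' w' ->
  scvg (fun n => u n + u' n) (w + w').
Proof.
move=> h h' e e0; have e2 : 0 < e / 2 by lra.
have [n1 h1] := h _ e2; have [n2 h2] := h' _ e2.
exists (maxn n1 n2) => n; rewrite geq_max => /andP[/h1 + /h2].
have := rnormD (u n - w) (u' n - w'); rewrite opprD addrACA; lra.
Qed.

Lemma blin_id : blin id.
Proof. by split => //; exists 1 => // u; rewrite mul1r. Qed.
Lemma blin_scale a : blin ( *:%R a).
Proof.
split; [exact: scalerDr|by move=> b u; rewrite !scalerA mulrC|].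
exists (Re `|a|); first by rewrite -ler0c RRe_real ?ger0_real.
move=> u; rewrite -lecR rmorphM /= -!normE normrZ.
exact: lexx.
Qed.
Lemma blin_add A B : blin A -> blin B -> blin (fun u => A u + B u).
Proof.
move=> [aA zA [M M0 hM]] [aB zB [M' M0' hM']]; split.
- by move=> u v; rewrite aA aB addrACA.
- by move=> a u; rewrite zA zB scalerDr.
- exists (M + M'); first exact: addr_ge0.
  move=> u; apply: le_trans (rnormD _ _) _; rewrite mulrDl; exact: lerD.
Qed.
Lemma blin_comp A B : blin A -> blin B -> blin (A \o B).
Proof.
move=> [aA zA [M M0 hM]] [aB zB [M' M0' hM']]; split.
- by move=> u v /=; rewrite aB aA.
- by move=> a u /=; rewrite zB zA.
- exists (M * M'); first exact: mulr_ge0.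
  by move=> u /=; apply: le_trans (hM _) _; rewrite -mulrA ler_wpM2l.
Qed.
Lemma blin_sub A B : blin A -> blin B -> blin (fun u => A u - B u).
Proof.
move=> bA bB; have := blin_add bA (blin_comp (blin_scale (-1)) bB).
by congr blin; apply/funext => u /=; rewrite scaleN1r.
Qed.

(** Linearity comes from the uniqueness of the orthogonal decomposition. For complex scalars, [ripZ]
    moves the conjugate scalar onto the test vector, which stays in [W]. *)
Lemma proj_exists (W : set V) : closed_subspace W -> exists P : V -> V,
  [/\ blin P, forall v, W (P v) & forall v x, W x -> rip (v - P v) x = 0].
Proof.
move=> cW; have /choice[P PP] : forall v,
    exists w, W w /\ forall x, W x -> rip (v - w) x = 0.
  by move=> v; have [w Ww wP] := orth_exists v cW; exists w.
have uniqP v w : W w -> (forall x, W x -> rip (v - w) x = 0) -> P v = w.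
  move=> Ww wP; have [WP h] := PP v.
  apply/eqP; rewrite -subr_eq0; apply/eqP/rip_eq0.
  have WB := closed_subspaceB cW WP Ww.
  have := h _ WB; have := wP _ WB.
  by rewrite !(ripBl, ripBr); lra.
exists P; split; last 2 first.
- by move=> v; exact: (PP v).1.
- by move=> v; exact: (PP v).2.
split.
- move=> u v; have [Wu hu] := PP u; have [Wv hv] := PP v.
  apply: uniqP; first exact: closed_subspaceD.
  by move=> x Wx; rewrite opprD addrACA ripDl hu // hv // addr0.
- move=> a u; have [Wu hu] := PP u; apply: uniqP; first exact: closed_subspaceZ.
  by move=> x Wx; rewrite -scalerBr ripZ hu //; exact: closed_subspaceZ.
- exists 1 => // u; rewrite mul1r rnorm_le; have [Wu /(_ _ Wu) hu] := PP u.
  have := rip_ge0 (u - P u).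
  by move: hu; rewrite !(ripBl, ripBr) (ripC (P u) u); lra.
Qed.

End Projection.

(** * The mean ergodic theorem *)

Section MeanErgodic.
Variables (R : realType) (V : hilbertType R).
Implicit Types (u v w x y : V) (a : R[i]) (r : R).
Variables (U U' : V -> V).
Hypothesis bU : blin U.
Hypothesis U'K : cancel U' U.
Hypothesis Uiso : forall u v, rip (U u) (U v) = rip u v.

(** The exponents start at 1 because conjugates by positive powers only are known to commute. *)
Definition emean n v : V := n.+1%:R^-1%:C%C *: \sum_(i < n.+1) iter i.+1 U v.

Lemma rnorm_iter n v : rnorm (iter n U v) = rnorm v.
Proof.
elim: n => //= n IH; rewrite -{}IH; apply/eqP; rewrite eq_le.
by rewrite !rnorm_le !Uiso lexx.
Qed.

Lemma iter_lin n a u v : iter n U (a *: u + v) = a *: iter n U u + iter n U v.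
Proof. by have [uD uZ _] := bU; elim: n => //= n ->; rewrite uD uZ. Qed.

Lemma emean_lin n a u v : emean n (a *: u + v) = a *: emean n u + emean n v.
Proof.
rewrite /emean (eq_bigr (fun i : 'I_n.+1 => a *: iter i.+1 U u + iter i.+1 U v)).
  by rewrite big_split -scaler_sumr /= scalerDr !scalerA mulrC.
by move=> i _; rewrite iter_lin.
Qed.

Lemma rnorm_sum (I : Type) (s : seq I) (F : I -> V) :
  rnorm (\sum_(i <- s) F i) <= \sum_(i <- s) rnorm (F i).
Proof.
elim/big_ind2: _ => [|v p w q hv hw|//]; first by rewrite rnorm0.
by apply: le_trans (rnormD _ _) _; exact: lerD.
Qed.

Lemma rnorm_emean n v : rnorm (emean n v) <= rnorm v.
Proof.
rewrite /emean rnormZ gtr0_norm ?invr_gt0 // ler_pdivrMl //.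
apply: le_trans (rnorm_sum _ _) _.
rewrite (eq_bigr (fun=> rnorm v)) => [|i _]; last exact: rnorm_iter.
by rewrite sumr_const card_ord mulr_natl.
Qed.

Lemma emean_blin n : blin (emean n).
Proof.
have h := emean_lin n; split.
- by move=> u v; rewrite -[u]scale1r h !scale1r.
- have h0 : emean n 0 = 0.
    by apply: (addrI (emean n 0)); rewrite -{1}[emean n 0]scale1r -h scale1r !addr0.
  by move=> a u; have := h a u 0; rewrite h0 !addr0.
- by exists 1 => // u; rewrite mul1r rnorm_emean.
Qed.

Lemma emean_fixed n x : U x = x -> emean n x = x.
Proof.
move=> Ux; rewrite /emean (eq_bigr (fun=> x)) => [|i _]; last first.
  by elim: (i.+1) => //= m ->.
rewrite sumr_const card_ord -(scaler_nat _ x) scalerA.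
have -> : (n.+1%:R : R[i]) = (n.+1%:R)%:C%C by rewrite rmorph_nat.
by rewrite -rmorphM /= mulVf ?pnatr_eq0 // scale1r.
Qed.

Lemma rip_iter n x y : U x = x -> rip (iter n U y) x = rip y x.
Proof. by move=> Ux; elim: n => //= n <-; rewrite -{1}Ux Uiso. Qed.

Lemma rip_suml (I : Type) (s : seq I) (F : I -> V) x :
  rip (\sum_(i <- s) F i) x = \sum_(i <- s) rip (F i) x.
Proof.
elim/big_ind2: _ => [|v p w q <- <-|//]; first by rewrite rip0l.
by rewrite ripDl.
Qed.

Lemma rip_emean n x y : U x = x -> rip (emean n y) x = rip y x.
Proof.
move=> Ux; rewrite /emean ripZl rip_suml (eq_bigr (fun=> rip y x)).
  by rewrite sumr_const card_ord -(mulr_natl (rip y x)) mulrA mulVf ?mul1r ?pnatr_eq0.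
by move=> i _; rewrite rip_iter.
Qed.

(** The sum telescopes to a vector of norm at most twice that of [x], which is divided by n + 1. *)
Lemma emean_coboundary x : scvg (fun n => emean n (x - U x)) 0.
Proof.
move=> e e0; have bx := rnorm_ge0 x.
have [|n0 n0P] := @natSinv_small _ (e / (2 * (rnorm x + 1))).
  by apply: divr_gt0 => //; lra.
exists n0 => n /n0P; rewrite subr0 /emean => hn.
have -> : \sum_(i < n.+1) iter i.+1 U (x - U x) = U x - iter n.+2 U x.
  rewrite -(big_mkord xpredT (fun i => iter i.+1 U (x - U x))).
  rewrite (eq_bigr (fun i => - (iter i.+2 U x - iter i.+1 U x))); last first.
    move=> i _; rewrite opprB addrC -scaleN1r iter_lin scaleN1r addrC.
    by rewrite [iter i.+2 U x]iterSr.
  by rewrite sumrN telescope_sumr // opprB.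
rewrite rnormZ gtr0_norm ?invr_gt0 //.
apply: (@le_lt_trans _ _ (n.+1%:R^-1 * (2 * (rnorm x + 1)))).
  apply: ler_wpM2l; first by rewrite invr_ge0.
  apply: le_trans (rnormD _ _) _; rewrite rnormN rnorm_iter (rnorm_iter 1 x).
  lra.
by rewrite -ltr_pdivlMr //; lra.
Qed.

(** The vectors whose means tend to 0 form a closed subspace [W] containing the coboundaries; the
    limit [f] is the component of [v] orthogonal to [W]. *)
Lemma mean_ergodic v : exists f, [/\ U f = f, scvg (emean ^~ v) f &
  forall x, U x = x -> rip (v - f) x = 0].
Proof.
pose W := [set w | scvg (emean ^~ w) 0].
have cW : closed_subspace W.
  split.
  - apply: scvg_closed => u w uW uw e e0.
    have e2 : 0 < e / 2 by lra.
    have [n1 /(_ _ (leqnn _)) h1] := uw _ e2; have [n2 h2] := uW n1 _ e2.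
    exists n2 => n /h2; rewrite !subr0.
    have := rnormD (emean n (u n1)) (emean n (w - u n1)).
    have [cD _ _] := emean_blin n; rewrite -cD addrC subrK.
    have := rnorm_emean n (w - u n1); rewrite rnormC; lra.
  - move=> e e0; exists 0%N => n _; rewrite (blin0 (emean_blin n)) subrr.
    by rewrite rnorm0.
  - move=> a u w Wu Ww; rewrite /W /=.
    have := scvgD (scvg_blin (blin_scale V a) Wu) Ww.
    rewrite scaler0 addr0 => h e /h[n0 hn]; exists n0 => n /hn.
    by rewrite emean_lin.
have [w Ww wP] := orth_exists v cW; exists (v - w).
have [uD uZ _] := bU.
have fx : U (v - w) = v - w.
  set f := v - w in wP *; suff : U' f = f by move=> {1}<-; rewrite U'K.
  apply/eqP; rewrite eq_sym -subr_eq0; apply/eqP/rip_eq0.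
  (* Pairing [f] with the coboundary of [x] gives the pairing of f - U' f with [x], which is the
     squared norm of [x]. *)
  set x := f - U' f; have := wP _ (emean_coboundary x).
  by rewrite ripBr -{2}(U'K f) Uiso -ripBl.
split => // [|x Ux].
  move=> e e0; have [n0 h] := Ww e e0; exists n0 => n /h; rewrite subr0.
  have [cD _ _] := emean_blin n; rewrite -(emean_fixed n fx).
  by rewrite -(blinB _ _ (emean_blin n)) opprB addrC subrK.
(* Pairing with the fixed vector [x] takes the same value on [w] and on its means, which tend to
   0. *)
rewrite opprB addrC subrK; apply/eqP; rewrite -normr_le0 leNgt; apply/negP => h0.
have p0 : 0 < rnorm x + 1 by rewrite ltr_wpDl ?rnorm_ge0.
have [|n0 /(_ _ (leqnn _))] := Ww (`|rip w x| / (rnorm x + 1)); first exact: divr_gt0.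
rewrite subr0 ltr_pdivlMr // -(rip_emean n0 w Ux) => h.
have := rip_abs (emean n0 w) x; have := rnorm_ge0 (emean n0 w); lra.
Qed.

End MeanErgodic.

(** * Square roots of positive operators *)

Section SquareRoot.
Variables (R : realType) (V : hilbertType R).
Implicit Types (u v w x y : V) (a : R[i]) (r : R).
Variable A : V -> V.
Hypothesis bA : blin A.
Hypothesis Asym : forall u v, rip (A u) v = rip u (A v).
Hypothesis A1 : forall u, rnorm (A u) <= rnorm u.

Let X u := u - A (A u).
Fixpoint sqrt_approx n : V -> V := if n is m.+1 then
  fun u => 2^-1%:C%C *: (X u + sqrt_approx m (sqrt_approx m u)) else fun=> 0.
(** The same recursion with [X] replaced by 1: a scalar majorant whose increments control those of
    the approximants. *)
Fixpoint sqrt_bound n : R := if n is m.+1 then (1 + sqrt_bound m ^+ 2) / 2 else 0.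
Local Notation Y := sqrt_approx.
Local Notation b := sqrt_bound.

Let bX : blin X.
Proof. by apply: blin_sub; [exact: blin_id|exact: (blin_comp bA bA)]. Qed.
(** The squared norm of X u is |u|^2 - 2 |A u|^2 + |A (A u)|^2, and the last term is at most |A
    u|^2. *)
Let X1 u : rnorm (X u) <= rnorm u.
Proof.
rewrite rnorm_le /X !(ripBl, ripBr) (ripC (A (A u)) u) -(Asym u) (Asym (A u)).
have := A1 (A u); rewrite rnorm_le (Asym (A u)); have := rip_ge0 (A u).
lra.
Qed.

Lemma sqrt_approx_blin n : blin (Y n).
Proof.
elim: n => [|n IH] /=.
  split; [by rewrite addr0|by move=> a u; rewrite scaler0|].
  by exists 0 => // u; rewrite mul0r rnorm0.
exact: (blin_comp (blin_scale V _) (blin_add bX (blin_comp IH IH))).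
Qed.

(** Each approximant is a polynomial in [A]. *)
Lemma sqrt_approx_comm B : blin B -> (forall u, B (A u) = A (B u)) ->
  forall n u, B (Y n u) = Y n (B u).
Proof.
move=> bB BA; have [BD BZ _] := bB; elim=> [|n IH] u /=; first exact: blin0.
by rewrite BZ BD !IH /X (blinB _ _ bB) !BA.
Qed.

Lemma sqrt_approx_comm2 m n u : Y m (Y n u) = Y n (Y m u).
Proof.
apply: sqrt_approx_comm; first exact: sqrt_approx_blin.
by move=> {}u; rewrite (sqrt_approx_comm bA).
Qed.

Lemma sqrt_bound01 n : 0 <= b n <= 1.
Proof.
elim: n => /= [|n /andP[h0 h1]]; first by rewrite lexx ler01.
by apply/andP; split; nra.
Qed.
Lemma sqrt_boundS n : b n <= b n.+1.
Proof. by have := sqr_ge0 (b n - 1); rewrite /=; nra. Qed.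

Lemma sqrt_approx_bound n u : rnorm (Y n u) <= b n * rnorm u.
Proof.
elim: n u => [|n IH] u /=; first by rewrite rnorm0 mul0r.
rewrite rnormZ ger0_norm ?invr_ge0 //; have := rnormD (X u) (Y n (Y n u)).
have h1 := X1 u; have h2 := IH (Y n u); have h3 := IH u.
have /andP[b0 _] := sqrt_bound01 n.
have : b n * rnorm (Y n u) <= b n * (b n * rnorm u) by rewrite ler_wpM2l.
lra.
Qed.

(** As the approximants commute, the difference of squares factors: the next increment is half of
    (Y_{n+1} + Y_n) applied to the current one. The bounds satisfy the same identity. *)
Lemma sqrt_approxS n u : rnorm (Y n.+1 u - Y n u) <= (b n.+1 - b n) * rnorm u.
Proof.
elim: n u => [|n IH] u.
  by have := sqrt_approx_bound 1 u; rewrite [Y 0 u]/= [b 0]/= !subr0.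
have [yD _ _] := sqrt_approx_blin n; have [yD1 _ _] := sqrt_approx_blin n.+1.
have -> : Y n.+2 u - Y n.+1 u =
    2^-1%:C%C *: (Y n.+1 (Y n.+1 u - Y n u) + Y n (Y n.+1 u - Y n u)).
  rewrite (blinB _ _ (sqrt_approx_blin n)) (blinB _ _ (sqrt_approx_blin n.+1)).
  rewrite (sqrt_approx_comm2 n.+1 n) addrA subrK.
  rewrite -[Y n.+2 u]/(2^-1%:C%C *: (X u + Y n.+1 (Y n.+1 u))).
  rewrite -{2}[Y n.+1 u]/(2^-1%:C%C *: (X u + Y n (Y n u))).
  by rewrite -scalerBr opprD addrACA subrr add0r.
rewrite rnormZ ger0_norm ?invr_ge0 //.
set z := Y n.+1 u - Y n u.
have h1 := rnormD (Y n.+1 z) (Y n z); have h2 := sqrt_approx_bound n z.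
have h3 := sqrt_approx_bound n.+1 z; have h4 := IH u; rewrite -/z in h4.
have /andP[b0 _] := sqrt_bound01 n; have /andP[b1 _] := sqrt_bound01 n.+1.
have h5 : (b n.+1 + b n) * rnorm z <= (b n.+1 + b n) * ((b n.+1 - b n) * rnorm u).
  by rewrite ler_wpM2l // addr_ge0.
have -> : b n.+2 - b n.+1 = (b n.+1 ^+ 2 - b n ^+ 2) / 2.
  by rewrite -[b n.+2]/((1 + b n.+1 ^+ 2) / 2) -{2}[b n.+1]/((1 + b n ^+ 2) / 2); lra.
move: h1 h2 h3 h5; move: (b n.+1) (b n) => p q; lra.
Qed.

Lemma sqrt_approx_le m n u : (m <= n)%N -> rnorm (Y n u - Y m u) <= (b n - b m) * rnorm u.
Proof.
move=> /subnK <-; elim: (n - m)%N => [|k IH].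
  by rewrite add0n !subrr rnorm0 mul0r.
have := sqrt_approxS (k + m) u.
have := rnormD (Y (k + m).+1 u - Y (k + m) u) (Y (k + m) u - Y m u).
by rewrite addrA subrK addSn; lra.
Qed.

Lemma sqrt_bound_cauchy e : 0 < e -> exists n0, forall n, (n0 <= n)%N -> b n - b n0 < e.
Proof.
move=> e0; pose D := range b.
have sD : has_sup D.
  split; first by exists (b 0), 0%N.
  by exists 1 => _ [n _ <-]; have /andP[] := sqrt_bound01 n.
have [_ [n0 _ <-] h] := sup_adherent e0 sD; exists n0 => n _.
have : b n <= sup D by apply: ub_le_sup; [case: sD|exists n].
lra.
Qed.

(* [S = 1 - Y] with [Y] the limit of the iteration [Y <- ((1 - A^2) + Y^2) / 2]. *)
Lemma sqrt_exists : exists S : V -> V,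
  [/\ blin S, forall u, S (S u) = A (A u), forall u, 0 <= rip (S u) u &
   forall B, blin B -> (forall u, B (A u) = A (B u)) -> forall u, B (S u) = S (B u)].
Proof.
have /choice[Yl YlP] : forall u, exists w, scvg (Y ^~ u) w.
  move=> u; apply: scvg_complete => e e0; have u0 := rnorm_ge0 u.
  have [|n0 h] := @sqrt_bound_cauchy (e / (2 * (rnorm u + 1))).
    by apply: divr_gt0 => //; lra.
  have hh n : (n0 <= n)%N -> rnorm (Y n u - Y n0 u) < e / 2.
    move=> hn; apply: le_lt_trans (sqrt_approx_le u hn) _.
    have := h n hn; rewrite ltr_pdivlMr; last by lra.
    have /andP[_ _] := sqrt_bound01 n.
    have : b n0 <= b n.
      rewrite -(subnK hn); elim: (n - n0)%N => // k /le_trans -> //.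
      exact: sqrt_boundS.
    move: (b n) (b n0) (rnorm u) u0 => p q t; nra.
  exists n0 => m n /hh hm /hh hn; have := rnormD (Y m u - Y n0 u) (Y n0 u - Y n u).
  rewrite addrA subrK (rnormC (Y n0 u)); lra.
have Yl1 u : rnorm (Yl u) <= rnorm u.
  rewrite leNgt; apply/negP => h.
  have [|n /(_ _ (leqnn _)) hn] := YlP u (rnorm (Yl u) - rnorm u); first by lra.
  have := rnormD (Yl u - Y n u) (Y n u); rewrite subrK rnormC.
  have := sqrt_approx_bound n u; have /andP[_ b1] := sqrt_bound01 n.
  have : b n * rnorm u <= 1 * rnorm u by rewrite ler_wpM2r ?rnorm_ge0.
  lra.
have bY : blin Yl.
  split.
  - move=> u v; apply: (scvg_uniq (YlP _)).
    have := scvgD (YlP u) (YlP v) => h e /h[n0 hn]; exists n0 => n /hn.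
    by have [-> _ _] := sqrt_approx_blin n.
  - move=> a u; apply: (scvg_uniq (YlP _)).
    have := scvg_blin (blin_scale V a) (YlP u) => h e /h[n0 hn]; exists n0 => n /hn.
    by have [_ -> _] := sqrt_approx_blin n.
  - by exists 1 => // u; rewrite mul1r.
have Yfix u : Yl u = 2^-1%:C%C *: (X u + Yl (Yl u)).
  apply: (@scvg_uniq _ _ (fun n => Y n.+1 u)).
    by move=> e e0; have [n0 hn] := YlP u e e0; exists n0 => n hm; apply: hn; exact: leqW.
  move=> e e0; have e2 : 0 < e / 2 by lra.
  have [n1 h1] := YlP u _ e2; have [n2 h2] := YlP (Yl u) _ e2.
  exists (maxn n1 n2) => n; rewrite geq_max => /andP[/h1 k1 /h2 k2] /=.
  rewrite -scalerBr rnormZ ger0_norm ?invr_ge0 // opprD addrACA subrr add0r.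
  have := rnormD (Y n (Y n u - Yl u)) (Y n (Yl u) - Yl (Yl u)).
  rewrite {1}(blinB _ _ (sqrt_approx_blin n)) addrA subrK.
  have := sqrt_approx_bound n (Y n u - Yl u); have /andP[_ b1] := sqrt_bound01 n.
  have : b n * rnorm (Y n u - Yl u) <= 1 * rnorm (Y n u - Yl u).
    by rewrite ler_wpM2r ?rnorm_ge0.
  move: (rnorm_ge0 (Y n (Y n u) - Yl (Yl u))); lra.
exists (fun u => u - Yl u); split.
- by apply: blin_sub => //; exact: blin_id.
- move=> u; rewrite (blinB _ _ bY).
  (* By the fixed point equation 2 Y = X + Y^2, so (1 - Y)^2 = 1 - X = A^2. *)
  have -> : Yl (Yl u) = Yl u + Yl u - X u.
    have -> : Yl u + Yl u = X u + Yl (Yl u).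
      rewrite {1 2}(Yfix u) -scalerDl -rmorphD /= [_^-1 + _](_ : _ = 1); last by lra.
      by rewrite scale1r.
    by rewrite [X u + _]addrC addrK.
  rewrite /X; set a := A (A u); set y := Yl u.
  by rewrite !opprD !opprK !addrA !subrK subrr add0r.
(* Positivity of 1 - Y holds because Y is a contraction. *)
- move=> u; rewrite ripBl subr_ge0; apply: le_trans (rip_CS _ _) _.
  by rewrite -rnorm2 expr2 ler_wpM2r ?rnorm_ge0.
- move=> B bB BA u; rewrite (blinB _ _ bB); congr (_ - _).
  apply: (scvg_uniq (scvg_blin bB (YlP u))).
  have := YlP (B u) => h e /h[n0 hn]; exists n0 => n /hn /=.
  by rewrite (sqrt_approx_comm bB).
Qed.

End SquareRoot.

(** * Spherical representations *)

Section GelfandPair.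
Variables (R : realType) (G : topologicalGroupType) (V : hilbertType R).
Variables (pi : unitary_rep G V) (K : set G).
Implicit Types (u v w x y : V) (a : R[i]) (g h : G).
Local Notation H := (fixed_vectors pi K).

Lemma rep_rip g u v : rip (pi g u) (pi g v) = rip u v.
Proof. by rewrite /rip rep_unitary. Qed.
Lemma rep_ripV g u v : rip (pi g u) v = rip u (pi (g^-1)%g v).
Proof. by rewrite -(rep_rip g u) -repM mulgV rep1. Qed.
Lemma rep_blin g : blin (pi g).
Proof.
split; [exact: linearD|by move=> a u; rewrite linearZ|].
by exists 1 => // u; rewrite mul1r rnorm_le rep_rip.
Qed.

Lemma rip_scvg (u : nat -> V) w x : scvg u w ->
  (forall n, rip (u n) x = 0) -> rip w x = 0.
Proof.
move=> uw ux; apply/eqP; rewrite -normr_le0 leNgt; apply/negP => h0.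
have p0 : 0 < rnorm x + 1 by rewrite ltr_wpDl ?rnorm_ge0.
have [|n /(_ _ (leqnn _))] := uw (`|rip w x| / (rnorm x + 1)); first exact: divr_gt0.
rewrite ltr_pdivlMr // => h.
have := rip_abs (u n - w) x; rewrite ripBl ux sub0r normrN.
have := rnorm_ge0 (u n - w); lra.
Qed.

Lemma blin_eq_closed A B : blin A -> blin B -> closed [set v : V | A v = B v].
Proof.
move=> bA bB; apply: scvg_closed => u w uE uw.
apply: (scvg_uniq (scvg_blin bA uw)) => e e0.
have [n0 hn] := scvg_blin bB uw e0.
by exists n0 => n /hn; rewrite /= (uE n).
Qed.

Lemma fixed_closed_subspace : closed_subspace H.
Proof.
split.
- apply: scvg_closed => u w uH uw g Kg.
  apply: (scvg_uniq (scvg_blin (rep_blin g) uw)) => e e0.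
  by have [n0 hn] := uw _ e0; exists n0 => n /hn; rewrite /= uH.
- by move=> g _; rewrite linear0.
- by move=> a u v Hu Hv g Kg; rewrite linearP Hu // Hv.
Qed.

Variable P : V -> V.
Hypothesis bP : blin P.
Hypothesis PH : forall v, H (P v).
Hypothesis P_orth : forall v x, H x -> rip (v - P v) x = 0.

Lemma proj_fixed v : H v -> P v = v.
Proof.
move=> Hv; apply/eqP; rewrite eq_sym -subr_eq0; apply/eqP/rip_eq0.
by apply: P_orth; exact: closed_subspaceB fixed_closed_subspace Hv (PH v).
Qed.
Lemma proj_idem v : P (P v) = P v.
Proof. exact: proj_fixed. Qed.
Lemma proj_ripl v x : H x -> rip (P v) x = rip v x.
Proof. by move=> /(P_orth v); rewrite ripBl => /eqP; rewrite subr_eq0 => /eqP. Qed.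
Lemma proj_sym u v : rip (P u) v = rip u (P v).
Proof. by rewrite ripC -proj_ripl // ripC proj_ripl. Qed.

Hypothesis irr : irreducible pi.

(** Irreducibility passes to [H] with the compressions P pi(g). The set [Z] is a closed invariant
    subspace containing [W]; if it is everything, taking g = 1 puts [H] inside [W]. *)
Lemma fixed_irreducible (W : set V) : closed_subspace W -> W `<=` H ->
  (forall g v, W v -> W (P (pi g v))) -> W `<=` [set 0] \/ H `<=` W.
Proof.
move=> cW WH WP; have [clW W0 WL] := cW.
pose Z := [set v | forall g, W (P (pi g v))].
have [] := irr.2 Z.
- split.
  + apply: scvg_closed => u w uZ uw g.
    apply: (closed_scvg (u := fun n => P (pi g (u n))) clW) => [n|]; first exact: uZ.
    exact: scvg_blin (blin_comp bP (rep_blin g)) uw.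
  + by move=> g; rewrite linear0 (blin0 bP).
  + move=> a u v Zu Zv g; have [PD PZ _] := bP.
    by rewrite linearP PD PZ; exact: WL.
- by move=> g v Zv h; rewrite -repM; exact: Zv.
- by move=> ZE; left => v Wv; rewrite -ZE => g; exact: WP.
- move=> ZE; right => v Hv; have /(_ 1%g) : Z v by rewrite ZE.
  by rewrite rep1 proj_fixed.
Qed.

(* With C = (A - l) / c and S the positive square root of C^2, the kernel of
   S - C in H is invariant, hence C = S >= 0 or C = - S <= 0 on H. This holds
   for all l, which leaves A no choice but a scalar. *)
Lemma symmetric_scalar (A : V -> V) : blin A ->
  (forall u v, rip (A u) v = rip u (A v)) ->
  (forall v, P (A v) = A v) -> (forall v, A (P v) = A v) ->
  (forall g v, P (pi g (A v)) = A (P (pi g (P v)))) ->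
  exists m : R, forall v, H v -> A v = m%:C%C *: v.
Proof.
move=> bA Asym PA AP AO; have [AD AZ [M M0 AM]] := bA.
have dich (l : R) : (forall v, H v -> l * rip v v <= rip (A v) v) \/
                    (forall v, H v -> rip (A v) v <= l * rip v v).
  (* This exceeds the norm of A - l, so that [C] is a contraction, and it is positive. *)
  pose c := M + `|l| + 1.
  have c0 : 0 < c by rewrite /c ltr_wpDl // addr_ge0.
  pose C v := c^-1%:C%C *: (A v - l%:C%C *: v).
  have bC : blin C := blin_comp (blin_scale V _) (blin_sub bA (blin_scale V _)).
  have Csym u v : rip (C u) v = rip u (C v).
    by rewrite /C ripZl ripZr ripBl ripBr ripZl ripZr Asym.
  have C1 v : rnorm (C v) <= rnorm v.
    rewrite /C rnormZ gtr0_norm ?invr_gt0 // ler_pdivrMl //.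
    have := rnormD (A v) (- (l%:C%C *: v)); rewrite rnormN rnormZ.
    by have := AM v; have := rnorm_ge0 v; rewrite /c; lra.
  have [S [bS S2 S0 SB]] := sqrt_exists bC Csym C1.
  have bO g : blin (fun v => P (pi g (P v))).
    exact: blin_comp bP (blin_comp (rep_blin g) bP).
  have [PD PZ _] := bP.
  have PC v : P (C v) = C (P v).
    by rewrite /C PZ (blinB _ _ bP) PA PZ AP.
  have OC g v : P (pi g (P (C v))) = C (P (pi g (P v))).
    rewrite PC /C linearZ PZ linearB (blinB _ _ bP) linearZ /= PZ AP.
    congr (_ *: (_ - _)).
    exact: AO.
  have SP v : P (S v) = S (P v) by apply: SB.
  have SO g v : P (pi g (P (S v))) = S (P (pi g (P v))).
    by apply: (SB _ (bO g)) => u; exact: OC.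
  pose W := H `&` [set v | S v = C v].
  have hS v : H v -> H (S v) by move=> Hv; rewrite -(proj_fixed Hv) -SP.
  have hC v : H v -> H (C v) by move=> Hv; rewrite -(proj_fixed Hv) -PC.
  have cW : closed_subspace W.
    have [clH H0 HL] := fixed_closed_subspace; split.
    - apply: closedI => //; exact: blin_eq_closed.
    - by split=> //=; rewrite !blin0.
    - move=> a u v [Hu Su] [Hv Sv]; split; first exact: HL.
      rewrite /= in Su Sv *.
      by have [-> -> _] := bS; have [-> -> _] := bC; rewrite Su Sv.
  have WP g v : W v -> W (P (pi g v)).
    move=> [Hv Sv]; split => //=; have := SO g v; have := OC g v.
    rewrite SP PC /= (proj_fixed Hv) Sv.
    by move=> <- <-.
  have CA v : rip (A v) v - l * rip v v = c * rip (C v) v.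
    by rewrite /C ripZl ripBl ripZl mulrA mulfV ?mul1r // gt_eqF.
  have [W0|WH] := fixed_irreducible cW (@subIsetl _ _ _) WP; [right|left] => v Hv.
    (* Since S^2 = C^2 and S commutes with C, S - C annihilates S v + C v. *)
    have : W (S v + C v).
      split.
        by apply: closed_subspaceD fixed_closed_subspace _ _; [exact: hS|exact: hC].
      have [SD _ _] := bS; have [CD _ _] := bC; rewrite /= SD CD S2 addrC; congr (_ + _).
      by symmetry; apply: SB.
    move=> /W0 /eqP; rewrite addrC addr_eq0 => /eqP CS.
    have := CA v; rewrite CS ripNl; have := mulr_ge0 (ltW c0) (S0 v); lra.
  have [_ /= SC] := WH v Hv.
  have := CA v; rewrite -SC; have := mulr_ge0 (ltW c0) (S0 v); lra.
have [[x [Hx x0]]|noH] := pselect (exists x, H x /\ x <> 0); last first.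
  exists 0 => v Hv; have -> : v = 0 by apply: contrapT => v0; apply: noH; exists v.
  by rewrite scaler0 (blin0 bA).
have pos v : v <> 0 -> 0 < rip v v.
  move=> v0; rewrite lt_def rip_ge0 andbT; apply/eqP => h.
  by apply: v0; exact: rip_eq0.
pose m := rip (A x) x / rip x x.
have mE : rip (A x) x = m * rip x x by rewrite divfK // gt_eqF // pos.
exists m => v Hv.
have qm y : H y -> rip (A y) y = m * rip y y.
  move=> Hy; have [->|/eqP y0] := eqVneq y 0; first by rewrite !rip0r mulr0.
  have yp := pos _ y0; have xp := pos _ x0.
  pose m' := rip (A y) y / rip y y.
  have m'E : rip (A y) y = m' * rip y y by rewrite divfK // gt_eqF.
  have mm (l : R) : ~ (m < l < m') /\ ~ (m' < l < m).
    have [h|h] := dich l; have := h _ Hx; have := h _ Hy;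
      rewrite mE m'E !ler_pM2r // => h1 h2.
      by split => /andP[]; lra.
    by split => /andP[]; lra.
  (* Two distinct Rayleigh quotients would lie strictly on either side of their midpoint, against
     the dichotomy there. *)
  have [n1 n2] := mm ((m + m') / 2).
  have -> // : m = m'.
  have [mm'|mm'|//] := ltgtP m m'; [case: n1|case: n2]; apply/andP; split; lra.
have HA y : H y -> H (A y) by move=> Hy; rewrite -PA.
set D := A v - m%:C%C *: v.
have HD : H D.
  apply: closed_subspaceB fixed_closed_subspace _ _; first exact: HA.
  exact: closed_subspaceZ fixed_closed_subspace _.
have DE : D = A v - m%:C%C *: v by []; clearbody D.
have : rip D D = 0.
  (* Polarization: the form of A - m vanishes at v, D and v + D, hence so does the pairing of A v -
     m v = D with D. *)
  have Hs := closed_subspaceD fixed_closed_subspace Hv HD.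
  have := qm _ Hs; have := qm _ Hv; have := qm _ HD.
  rewrite AD !(ripDl, ripDr) (ripC (A D) v) -(Asym v D) (ripC D v) => h1 h2 h3.
  rewrite {1}DE ripBl ripZl; lra.
rewrite DE; by move=> /rip_eq0 /eqP; rewrite subr_eq0 => /eqP.
Qed.

Hypothesis comm : forall g h v, H v ->
  P (pi g (P (pi h v))) = P (pi h (P (pi g v))).

(** The adjoint of B = P pi(g) P is B' = P pi(g^-1) P, so B + B' and i (B - B') are symmetric. Both
    commute with all compressions, hence act on [H] by real scalars m and m', and B acts by (m - i
    m') / 2. *)
Lemma fixed_scalar g : exists a, forall v, H v -> P (pi g v) = a *: v.
Proof.
have bO h : blin (fun v => P (pi h (P v))).
  exact: blin_comp bP (blin_comp (rep_blin h) bP).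
have [PD PZ _] := bP.
have Osym h u v : rip (P (pi h (P u))) v = rip u (P (pi (h^-1)%g (P v))).
  by rewrite proj_sym rep_ripV proj_sym.
have [||||h v|m mP] := @symmetric_scalar
  (fun v => P (pi g (P v)) + P (pi (g^-1)%g (P v))).
- exact: blin_add.
- by move=> u v; rewrite ripDl ripDr !Osym invgK addrC.
- by move=> v; rewrite PD !proj_idem.
- by move=> v; rewrite !proj_idem.
- by rewrite linearD PD !proj_idem (comm h g) // (comm h g^-1%g).
have [||||h v|m' mP'] := @symmetric_scalar
  (fun v => 'i%C *: (P (pi g (P v)) - P (pi (g^-1)%g (P v)))).
- exact: blin_comp (blin_scale V _) (blin_sub _ _).
- move=> u v; rewrite ripZ ripBl !Osym invgK -ripBr; congr rip.
  have [_ -> _] := bO g; have [_ -> _] := bO g^-1%g.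
  rewrite -scalerBr -opprB scalerN -scaleNr; congr (_ *: _).
  by apply/eqP; rewrite eq_complex /= oppr0 opprK !eqxx.
- by move=> v; rewrite PZ (blinB _ _ bP) !proj_idem.
- by move=> v; rewrite !proj_idem.
- rewrite linearZ PZ linearB (blinB _ _ bP) !proj_idem (comm h g) // (comm h g^-1%g) //.
exists (2^-1 * (m%:C%C - 'i%C * m'%:C%C)) => v Hv.
have := mP v Hv; have := mP' v Hv; rewrite (proj_fixed Hv).
set s := P (pi g v); set t := P _ => h1 h2.
rewrite -scalerA scalerBl -(scalerA 'i%C) -h1 -h2.
have -> (w : V) : 'i%C *: ('i%C *: w) = - w.
  by rewrite scalerA -expr2 sqr_i scaleN1r.
rewrite opprK addrACA [t + - t]addrN addr0 -mulr2n -(scaler_nat _ s) scalerA.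
by rewrite mulVf ?scale1r // pnatr_eq0.
Qed.

(** The compressions being scalar, the orthogonal complement in [H] of the line of a nonzero [x] is
    invariant. It misses [x], so it is 0. *)
Lemma fixed_dim_le1 : dim_le H 1.
Proof.
have [[x [Hx x0]]|noH] := pselect (exists x, H x /\ x <> 0); last first.
  have [_ H0 _] := fixed_closed_subspace.
  exists (fun=> 0) => // v Hv; exists (fun=> 0).
  have -> : v = 0 by apply: contrapT => v0; apply: noH; exists v.
  by rewrite big_ord1 scaler0.
exists (fun=> x) => // v Hv.
have xx : inner V x x != 0.
  by rewrite -inner_norm expf_eq0 /= normr_eq0; exact/eqP.
(* Orthogonality to all complex multiples of [x] makes up for [rip] being only a real part. *)
pose W := H `&` [set w | forall a, rip w (a *: x) = 0].
have [|||W0|HW] := @fixed_irreducible W.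
- have [clH H0 HL] := fixed_closed_subspace; split.
  + apply: scvg_closed => u w uW uw; split.
      by apply: (closed_scvg clH _ uw) => n; exact: (uW n).1.
    by move=> a; apply: (rip_scvg uw) => n; exact: (uW n).2.
  + by split => // a; rewrite rip0l.
  + move=> a u w [Hu hu] [Hw hw]; split; first exact: HL.
    by move=> b; rewrite ripDl ripZ scalerA hu hw addr0.
- exact: subIsetl.
- move=> g w [Hw hw]; split => // b.
  by have [a ->] := fixed_scalar g; rewrite // ripZ scalerA hw.
- exists (fun=> inner V v x / inner V x x); rewrite big_ord1.
  set c := _ / _; apply/eqP; rewrite -subr_eq0; apply/eqP; apply: W0.
  split.
    apply: closed_subspaceB fixed_closed_subspace Hv _.
    exact: closed_subspaceZ fixed_closed_subspace Hx.
  move=> a; rewrite /rip linearBl linearZl_LR !linearZr_LR /=.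
  by rewrite -[_ *: _]/(_ * _) -mulrBr divfK // subrr mulr0.
- by case: x0; apply: rip_eq0; have [_ /(_ 1)] := HW x Hx; rewrite scale1r.
Qed.

End GelfandPair.

(** * Limits of translates and commutation of the compressions *)

Section Sphericity.
Variables (R : realType) (G : topologicalGroupType) (V : hilbertType R).
Variables (pi : unitary_rep G V) (K : set G).
Implicit Types (u v w x y : V) (a : R[i]) (g h k t : G) (d n : nat).
Local Notation H := (fixed_vectors pi K).

Variables (s : G) (L : set G).
Hypothesis Ks : K s.
Hypothesis KLK : forall g, exists k1 k2 l, [/\ K k1, K k2, L l & g = (k1 * l * k2)%g].
Hypothesis conjX_comm : forall g h d, L g -> L h ->
  (g * conjX s d.+1 h = conjX s d.+1 h * g)%g.
(** In the tree the two families contain the automorphisms fixing branch 0, respectively branch 1,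
    pointwise; only their commutation with translates is recorded. *)
Hypothesis K_generated : forall D : set G,
  (forall g h, D g -> D h -> D (g * h)%g) -> (forall g, D g -> D g^-1%g) -> D s ->
  (forall t, K t ->
    (forall d h, L h -> t * conjX s d.+1 h = conjX s d.+1 h * t)%g -> D t) ->
  (forall t, K t ->
    (forall d h, L h -> t * conjX s^-1 d.+1 h = conjX s^-1 d.+1 h * t)%g -> D t) ->
  K `<=` D.

Variable P : V -> V.
Hypothesis bP : blin P.
Hypothesis PH : forall v, H (P v).
Hypothesis P_orth : forall v x, H x -> rip (v - P v) x = 0.

Lemma repK g : cancel (pi g) (pi g^-1%g).
Proof. by move=> v; rewrite -repM mulVg rep1. Qed.
Lemma repVK g : cancel (pi g^-1%g) (pi g).
Proof. by move=> v; rewrite -repM mulgV rep1. Qed.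
Lemma rep_iter g d v : pi (g ^+ d)%g v = iter d (pi g) v.
Proof. by elim: d => [|d IH]; rewrite ?rep1 // expgS repM IH. Qed.
Lemma rep_fixedV g v : pi g v = v -> pi g^-1%g v = v.
Proof. by move=> {1}<-; rewrite repK. Qed.
Lemma rep_fixedX g d v : pi g v = v -> pi (g ^+ d)%g v = v.
Proof. by move=> gv; rewrite rep_iter; elim: d => //= d ->. Qed.
Lemma rep_conjX g d h v : pi g v = v -> pi (conjX g d h) v = iter d (pi g) (pi h v).
Proof.
by move=> gv; rewrite !repM rep_iter (rep_fixedV (rep_fixedX d gv)).
Qed.

Lemma emean_rep g h v n : pi g v = v ->
  emean (pi g) n (pi h v) = n.+1%:R^-1%:C%C *: \sum_(i < n.+1) pi (conjX g i.+1 h) v.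
Proof. by move=> gv; congr (_ *: _); apply: eq_bigr => i _; rewrite rep_conjX. Qed.

(** An element fixing [v] and commuting with the conjugates of [h] fixes the means, hence their
    limit [f]. By [K_generated], [f] is in [H]; being already the projection onto the [s]-fixed
    vectors, it is P (pi h v). *)
Lemma emean_limit h v : L h -> H v ->
  scvg ((emean (pi s))^~ (pi h v)) (P (pi h v)) /\
  scvg ((emean (pi s^-1%g))^~ (pi h v)) (P (pi h v)).
Proof.
move=> Lh Hv; have sv := Hv _ Ks; have sv' := rep_fixedV sv.
have [f [sf cf fP]] := mean_ergodic (rep_blin pi s) (repVK s) (rep_rip pi s) (pi h v).
have [f' [sf' cf' fP']] := mean_ergodic (rep_blin pi s^-1%g) (repK s)
  (rep_rip pi s^-1%g) (pi h v).
(* Both are projections of the same vector, and [s] and its inverse have the same fixed vectors. *)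
have ff' : f' = f.
  have sf'' : pi s f' = f' by rewrite -{1}sf' repVK.
  apply/eqP; rewrite -subr_eq0; apply/eqP/rip_eq0.
  have e1 : pi s (f' - f) = f' - f by rewrite linearB /= sf sf''.
  have := fP _ e1; have := fP' _ (rep_fixedV e1).
  by rewrite !(ripBl, ripBr); lra.
rewrite {}ff' in sf' cf' fP' *.
have fixf g t : pi g v = v -> pi t v = v -> scvg ((emean (pi g))^~ (pi h v)) f ->
    (forall d, t * conjX g d.+1 h = conjX g d.+1 h * t)%g -> pi t f = f.
  move=> gv tv cg tg; apply: (scvg_uniq (scvg_blin (rep_blin pi t) cg)).
  have -> // : pi t \o (emean (pi g))^~ (pi h v) = (emean (pi g))^~ (pi h v).
  apply/funext => n /=; rewrite emean_rep // linearZ linear_sum; congr (_ *: _).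
  by apply: eq_bigr => i _ /=; rewrite -repM tg repM tv.
have Hf : H f.
  apply: (K_generated (D := [set t | pi t f = f])) => //=.
  - by move=> g k gf kf; rewrite repM kf.
  - by move=> g; exact: rep_fixedV.
  - by move=> t Kt tc; apply: (fixf s) => // [|d]; [exact: Hv|exact: tc].
  - by move=> t Kt tc; apply: (fixf s^-1%g) => // [|d]; [exact: Hv|exact: tc].
suff -> : P (pi h v) = f by [].
apply/eqP; rewrite -subr_eq0; apply/eqP/rip_eq0.
have HD : H (P (pi h v) - f).
  exact: closed_subspaceB (fixed_closed_subspace pi K) (PH _) Hf.
have := fP _ (HD _ Ks); have := P_orth (pi h v) HD.
by rewrite !(ripBl, ripBr); lra.
Qed.

(** Commuting [g] past s^d h s^-d leaves s^d on the far left, absorbed by the [s]-fixed [w]. What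
    remains is [h] applied to the backward translate s^-d g v. *)
Lemma rip_emean_comm g h v w n : L g -> L h -> H v -> H w ->
  rip (pi g (emean (pi s) n (pi h v))) w = rip (pi h (emean (pi s^-1%g) n (pi g v))) w.
Proof.
move=> Lg Lh Hv Hw; have sv := Hv _ Ks.
rewrite (emean_rep h n sv) (emean_rep g n (rep_fixedV sv)).
have rZ k (r : R) u : pi k (r%:C%C *: u) = r%:C%C *: pi k u by rewrite linearZ.
rewrite !rZ !ripZl !linear_sum !rip_suml; congr (_ * _).
apply: eq_bigr => i _ /=; rewrite -repM conjX_comm // /conjX !repM rep_ripV.
rewrite (rep_fixedV (rep_fixedX _ (Hw _ Ks))) expVgn invgK.
by rewrite (rep_fixedX _ sv).
Qed.

(** Passing to the limit in [rip_emean_comm] takes forward means for [h] and backward means for [g];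
    the test vector [w] is the difference of the two sides. *)
Lemma proj_comm_generic g h v : L g -> L h -> H v ->
  P (pi g (P (pi h v))) = P (pi h (P (pi g v))).
Proof.
move=> Lg Lh Hv; have [ch _] := emean_limit Lh Hv; have [_ cg] := emean_limit Lg Hv.
set a := P (pi h v) in ch *; set b := P (pi g v) in cg *.
have bN : blin (fun u => - u).
  have := blin_scale V (-1); congr blin; apply/funext => u; exact: scaleN1r.
have lim := scvgD (scvg_blin (rep_blin pi g) ch)
                  (scvg_blin (blin_comp bN (rep_blin pi h)) cg).
apply/eqP; rewrite -subr_eq0 -(blinB _ _ bP); apply/eqP/rip_eq0.
set w := P _; have Hw : H w by exact: PH.
rewrite (proj_ripl P_orth) //; apply: (rip_scvg lim) => n /=.
by rewrite ripBl rip_emean_comm // subrr.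
Qed.

Lemma proj_repl k v : K k -> P (pi k v) = P v.
Proof.
move=> Kk; apply/eqP; rewrite -subr_eq0 -(blinB _ _ bP); apply/eqP/rip_eq0.
set w := P _; have Hw : H w by exact: PH.
rewrite (proj_ripl P_orth) // ripBl rep_ripV (rep_fixedV (Hw _ Kk)).
by rewrite subrr.
Qed.

(** On [H], P pi(g) depends only on the double coset of [g], so both elements may be taken in
    [L]. *)
Lemma proj_comm g h v : H v -> P (pi g (P (pi h v))) = P (pi h (P (pi g v))).
Proof.
move=> Hv.
have [k1 [k2 [l [K1 K2 Ll ->]]]] := KLK g; have [k3 [k4 [m [K3 K4 Lm ->]]]] := KLK h.
have E i j (t : G) u : K i -> K j -> H u -> P (pi (i * t * j)%g u) = P (pi t u).
  by move=> Ki Kj Hu; rewrite !repM proj_repl // (Hu _ Kj).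
by rewrite !E //; exact: proj_comm_generic.
Qed.

End Sphericity.

Lemma spherical_dim_le1 (R : realType) (G : topologicalGroupType)
    (V : hilbertType R) (pi : unitary_rep G V) (K L : set G) (s : G) :
  K s ->
  (forall g, exists k1 k2 l, [/\ K k1, K k2, L l & g = (k1 * l * k2)%g]) ->
  (forall g h d, L g -> L h -> (g * conjX s d.+1 h = conjX s d.+1 h * g)%g) ->
  (forall D : set G,
    (forall g h, D g -> D h -> D (g * h)%g) -> (forall g, D g -> D g^-1%g) -> D s ->
    (forall t, K t ->
      (forall d h, L h -> t * conjX s d.+1 h = conjX s d.+1 h * t)%g -> D t) ->
    (forall t, K t ->
      (forall d h, L h -> t * conjX s^-1 d.+1 h = conjX s^-1 d.+1 h * t)%g -> D t) ->
    K `<=` D) ->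
  irreducible pi -> dim_le (fixed_vectors pi K) 1.
Proof.
move=> Ks KLK cX gen irr.
have [P [bP PH P_orth]] := proj_exists (fixed_closed_subspace pi K).
apply: (fixed_dim_le1 bP) => // g h v.
exact: proj_comm Ks KLK cX gen _ bP PH P_orth _ _ _.
Qed.

Theorem theorem5p1 (R : realType) (T : inftree) (V : hilbertType R)
    (pi : unitary_rep (hier T) V) :
  irreducible pi -> dim_le (fixed_vectors pi (Aut T)) 1.
Proof.
have [e [e' [eK e'K e_adj]]] := tree_coding T.
have [s As sE] := wauto_Aut eK e'K e_adj shiftw_auto.
apply: (@spherical_dim_le1 _ _ _ _ _ (local_part e e') s) => //.
- exact: (local_decomposition eK e'K e_adj sE).
- by move=> g h d; exact: (local_conjX_comm eK e'K sE).
(* Forward conjugates are supported on branch 0 and backward ones on branch 1, so they commute with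
   automorphisms trivial on that branch. *)
- move=> D DM DV Ds D0 D1; apply: (Aut_generated eK e'K e_adj sE DM DV Ds).
    move=> t At t0; apply: D0 => // d h Lh.
    apply: (disjoint_commute eK e'K (A := branch 0)) => // a.
    exact: (conjX_fixed eK e'K sE).
  move=> t At t1; apply: D1 => // d h Lh.
  apply: (disjoint_commute eK e'K (A := branch 1)) => // a.
  exact: (conjXV_fixed eK e'K sE).
Qed.
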